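(* Let $d\ge 1$, let $f\colon(0,\infty)\to(0,\infty)$ be a nondecreasing function, and let $Y_0(t)$, $t>0$, be the value at the spatial point $x=0$ of the mild solution to the stochastic heat equation on $\mathbb{R}^d$ with zero initial condition driven by additive standard Poisson noise (see context). Then, with probability one, $$\limsup_{t\to\infty}\frac{Y_0(t)}{f(t)}=\infty\quad\text{if } \int_1^\infty\frac{1}{f(t)}\,dt=\infty,\qquad\text{and}\qquad \limsup_{t\to\infty}\frac{Y_0(t)}{f(t)}=0\quad\text{if }\int_1^\infty\frac{1}{f(t)}\,dt<\infty.$$ Furthermore, almost surely, $$\liminf_{t\to\infty}\frac{Y_0(t)}{t}=1.$$
   Context: The heat kernel on $\mathbb{R}^d$ is $g(t,x)=(4\pi t)^{-d/2}e^{-|x|^2/(4t)}$ for $t>0$, and $g(t,x)=0$ for $t\le 0$, where $|\cdot|$ is the Euclidean norm. Standard Poisson noise is $\dot\Lambda=\sum_{i=1}^\infty\delta_{(\tau_i,\eta_i)}$, where $(\tau_i,\eta_i)_{i\ge1}$ are the points of a standard Poisson point process on $[0,\infty)\times\mathbb{R}^d$ (intensity equal to Lebesgue measure). The mild solution to $\partial_tY=\Delta Y+\dot\Lambda$, $Y(0,\cdot)=0$, is $Y(t,x)=\sum_{i=1}^\infty g(t-\tau_i,x-\eta_i)\mathbf 1_{\tau_i<t}$, and $Y_0(t)=Y(t,0)=\sum_{i=1}^\infty g(t-\tau_i,\eta_i)\mathbf 1_{\tau_i<t}$. *)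

(* Defs.v *)
From HB Require Import structures.
From mathcomp Require Import all_boot all_order all_algebra.
From mathcomp Require Import all_classical all_reals all_analysis.
From mathcomp Require Import measurable_realfun.
Set Implicit Arguments.
Unset Strict Implicit.
Unset Printing Implicit Defensive.
Import Order.TTheory GRing.Theory Num.Theory.
Import numFieldNormedType.Exports.
Local Open Scope classical_set_scope.
Local Open Scope ring_scope.

(* R^d is represented by d.-tuple R, which carries the product of the Borel
   sigma-algebras of its factors, that is, the Borel sigma-algebra of R^d. *)

Definition enorm (R : realType) (d : nat) (x : d.-tuple R) : R :=
  Num.sqrt (\sum_(i < d) tnth x i ^+ 2).

Definition tuple_sub (R : realType) (d : nat) (x y : d.-tuple R) : d.-tuple R :=
  [tuple tnth x i - tnth y i | i < d].

(* Lebesgue measure on R^d, as the d-fold product of Lebesgue measure on R. *)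
Fixpoint lebesgue_tuple (R : realType) (d : nat) : set (d.-tuple R) -> \bar R :=
  match d with
  | 0 => \d_([tuple] : 0.-tuple R)
  | n.+1 => pushforward (@lebesgue_measure R \x @lebesgue_tuple R n)%E
              (fun p : R * n.-tuple R => [tuple of p.1 :: p.2])
  end.

(* Lebesgue measure on [0, +oo[ x R^d, as a measure on R x R^d. *)
Definition lebesgue_space_time (R : realType) (d : nat)
    (A : set (R * d.-tuple R)) : \bar R :=
  (@lebesgue_measure R \x @lebesgue_tuple R d)%E
    (A `&` (`[0, +oo[%classic `*` [set: d.-tuple R])).

Definition mutually_independent (R : realType) (dT : measure_display)
    (T : measurableType dT) (P : probability T R) (n : nat)
    (N : 'I_n -> T -> \bar R) : Prop :=
  forall B : 'I_n -> set (\bar R), (forall j, measurable (B j)) ->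
    (P (\bigcap_(j in [set: 'I_n]) (N j @^-1` B j)) =
     \prod_(j < n) P (N j @^-1` B j))%E.

(* The random counting measure of the points X_0, X_1, .... *)
Definition point_measure (R : realType) (dT dE : measure_display)
    (T : measurableType dT) (E : measurableType dE) (X : nat -> T -> E)
    (w : T) : set E -> \bar R :=
  mseries (fun i => \d_(X i w)) 0.

(* The second argument of poisson_prob is ignored by its definition.
   poisson_prob is used rather than poisson_pmf because the latter is
   identically 1 at rate 0. *)
Definition is_poisson_point_process (R : realType) (dT dE : measure_display)
    (T : measurableType dT) (E : measurableType dE) (P : probability T R)
    (mu : set E -> \bar R) (X : nat -> T -> E) : Prop :=
  [/\ forall i, measurable_fun [set: T] (X i),
      forall (A : set E) (k : nat), measurable A -> (mu A < +oo)%E ->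
        P [set w | point_measure R X w A = k%:R%:E] =
        poisson_prob (fine (mu A)) k [set k] &
      forall (n : nat) (A : 'I_n -> set E), (forall j, measurable (A j)) ->
        trivIset [set: 'I_n] A ->
        mutually_independent P (fun j w => point_measure R X w (A j))].

Definition is_standard_poisson_noise (R : realType) (d : nat)
    (dT : measure_display) (T : measurableType dT) (P : probability T R)
    (tau : nat -> T -> R) (eta : nat -> T -> d.-tuple R) : Prop :=
  (forall i w, 0 <= tau i w) /\
  is_poisson_point_process P (@lebesgue_space_time R d)
    (fun i w => (tau i w, eta i w)).

Definition heat_kernel (R : realType) (d : nat) (t : R) (x : d.-tuple R) : R :=
  if 0 < t then
    (4 * pi * t) `^ (- (d%:R / 2)) * expR (- (enorm x ^+ 2 / (4 * t)))
  else 0.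

(* A series of nonnegative terms, with values in [0, +oo]. *)
Definition mild_solution (R : realType) (d : nat) (T : Type)
    (tau : nat -> T -> R) (eta : nat -> T -> d.-tuple R)
    (t : R) (x : d.-tuple R) (w : T) : \bar R :=
  (\sum_(0 <= i <oo)
     (heat_kernel (t - tau i w) (tuple_sub x (eta i w)) *
      (if tau i w < t then 1 else 0))%:E)%E.

Definition mild_solution0 (R : realType) (d : nat) (T : Type)
    (tau : nat -> T -> R) (eta : nat -> T -> d.-tuple R)
    (t : R) (w : T) : \bar R :=
  mild_solution tau eta t [tuple 0 | _ < d] w.

(* Main.v *)
Require Import Defs.
From HB Require Import structures.
From mathcomp Require Import all_boot all_order all_algebra.
From mathcomp Require Import all_classical all_reals all_analysis.
From mathcomp Require Import measurable_realfun.
From mathcomp Require Import zify.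
From mathcomp Require Import ring lra.
Set Implicit Arguments.
Unset Strict Implicit.
Unset Printing Implicit Defensive.
Import Order.TTheory GRing.Theory Num.Theory.
Import numFieldNormedType.Exports.
Local Open Scope classical_set_scope.
Local Open Scope ring_scope.

(** For a Poisson process with points [X_i] and intensity [mu], the sum
    [sum_i h (X_i)] has mean [int h] and variance [int h^2]; both formulas follow
    by identifying measures on a pi-system, the second one with [mu x mu] plus the
    image of [mu] on the diagonal, and they only use that the number of points in
    a set is Poisson distributed. Everything else is Chebyshev's inequality, void
    probabilities and the Borel-Cantelli lemma.

    - Limsup infinite: the boxes [[n, n + 1[ x ]-r_n, r_n[^d] with
      [r_n^d = a / f (n + 2)] have infinite total volume, so infinitely many of
      them contain a point [(s, y)]; at time [s + r_n^2] this point alone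
      contributes a multiple of [f (n + 2) / a].
    - Limsup zero: for [t] in [[n, n + 1]], the points before time [n - 1]
      contribute at most [2^d] times their contribution at time [n + 1], which is
      [O(n + f n)] by Chebyshev. For the recent points let [2^(dK)] be of the order
      of [f n]. None of them lies within distance of order [2^-K] from the origin,
      and for the others the kernel is dominated by the sum over [k <= K] of the
      kernels at the times [4^(1-k)], whose square has integral [O(2^(dK))].
    - Liminf: by Chebyshev at the times [k^2], the points that are not recent
      contribute about [k^2] there, and the recent ones add [o(k^2)] by Markov. *)

(** * Bundling sigma-finite measures *)

Section product_measure_sigma_finite.
Local Open Scope ereal_scope.
Context d1 d2 (T1 : measurableType d1) (T2 : measurableType d2) (R : realType).
Variable m1 : {sigma_finite_measure set T1 -> \bar R}.
Variable m2 : {sigma_finite_measure set T2 -> \bar R}.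

Lemma product_measure_sigma_finite : sigma_finite setT (m1 \x m2).
Proof.
have /sigma_finiteP[F [TF ndF Foo]] := sigma_finiteT m1.
have /sigma_finiteP[G [TG ndG Goo]] := sigma_finiteT m2.
exists (fun n => F n `*` G n).
  rewrite -setXTT TF TG predeqE => -[x y]; split; last first.
    by move=> [n _ []/= ? ?]; split; exists n.
  move=> [/= [n _ Fnx] [k _ Gky]]; exists (maxn n k) => //; split.
  - by move: x Fnx; exact/subsetPset/ndF/leq_maxl.
  - by move: y Gky; exact/subsetPset/ndG/leq_maxr.
move=> k; have [? ?] := Foo k; have [? ?] := Goo k; split.
  exact: measurableX.
by rewrite product_measure1E// lte_mul_pinfty// ge0_fin_numE.
Qed.

End product_measure_sigma_finite.

(** Names the canonical measure structure on a pushforward, with the proof of measurability passed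
    explicitly. *)
Definition pushforward_measure d d' (T1 : measurableType d)
    (T2 : measurableType d') (R : realType) (m : {measure set T1 -> \bar R})
    (f : T1 -> T2) (mf : measurable_fun setT f) : {measure set T2 -> \bar R} :=
  measure_function_pushforward__canonical__measure_function_Measure m mf.

Section exists_sigma_finite_measure.
Local Open Scope ereal_scope.
Context d (T : measurableType d) (R : realType) (m : set T -> \bar R).
Hypotheses (m0 : m set0 = 0) (m_ge0 : forall A, 0 <= m A)
  (m_add : semi_sigma_additive m) (m_sf : sigma_finite setT m).

(* An alias, so that the instances below do not apply to arbitrary functions. *)
Definition set_fun_alias := m.
HB.instance Definition _ := isMeasure.Build _ _ _ set_fun_alias m0 m_ge0 m_add.
HB.instance Definition _ := Measure_isSigmaFinite.Build _ _ _ set_fun_alias m_sf.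

(** Turns the measure axioms, once proved for a bare set function, into a bundled measure that is
    equal to it. *)
Lemma exists_sigma_finite_measure :
  exists m2 : {sigma_finite_measure set T -> \bar R}, m2 = m :> (set T -> _).
Proof. by exists set_fun_alias. Qed.

End exists_sigma_finite_measure.

(** * Lebesgue measure on tuples *)

Section lebesgue_tuple_measure.
Context {R : realType}.
Local Open Scope ereal_scope.

Definition consp (n : nat) (p : (measurableTypeR R * n.-tuple R)%type) : n.+1.-tuple R :=
  [tuple of p.1 :: p.2].

Lemma measurable_consp n : measurable_fun setT (@consp n).
Proof.
apply: measurable_cons; last exact: measurable_snd.
exact: (@measurable_fst _ _ (measurableTypeR R) (n.-tuple R)).
Qed.

Lemma tnth_consp0 n (p : (measurableTypeR R * n.-tuple R)%type) :
  tnth (consp p) ord0 = p.1.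
Proof. by []. Qed.

Lemma tnth_consp_lift n (p : (measurableTypeR R * n.-tuple R)%type) i :
  tnth (consp p) (lift ord0 i) = tnth p.2 i.
Proof. by rewrite !(tnth_nth 0%R). Qed.

(** Inverse of [consp]; preimages under it carry a cover of the product by sets of finite measure
    over to tuples. *)
Definition unconsp (n : nat) (t : n.+1.-tuple R) : (measurableTypeR R * n.-tuple R)%type :=
  (thead t, [tuple of behead t]).

Lemma measurable_unconsp n : measurable_fun setT (@unconsp n).
Proof.
apply/measurable_fun_pairP; split; last exact: measurable_behead.
exact: measurable_tnth.
Qed.

Lemma conspK n : cancel (@consp n) (@unconsp n).
Proof.
move=> [x t]; rewrite /consp /unconsp/= theadE.
by congr pair; exact/val_inj.
Qed.

Lemma lebesgue_tupleS n : @lebesgue_tuple R n.+1 =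
  pushforward (@lebesgue_measure R \x @lebesgue_tuple R n) (@consp n).
Proof. by []. Qed.

(** Each product needs its second factor to be a sigma-finite measure already, so the induction
    produces a bundled measure in every dimension; the instances for [lebesgue_tuple] itself are
    read off afterwards. *)
Lemma lebesgue_tuple_sigma_finite_measure n :
  exists m : {sigma_finite_measure set (n.-tuple R) -> \bar R},
    (m : set _ -> _) = @lebesgue_tuple R n.
Proof.
elim: n => [|n [m mE]].
  by exists (\d_([tuple] : 0.-tuple R)).
pose M : {measure set (measurableTypeR R * n.-tuple R)%type -> \bar R} :=
  (@lebesgue_measure R \x m).
have mc := @measurable_consp n.
pose m1 := pushforward_measure M mc.
have sf : sigma_finite setT m1.
  have /sigma_finiteP[F [TF _ Foo]] :=
    product_measure_sigma_finite (@lebesgue_measure R) m.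
  exists (fun k => @unconsp n @^-1` F k).
    rewrite -preimage_bigcup -TF preimage_setT//.
  move=> k; have [mF Fk] := Foo k; split.
    by rewrite -[X in measurable X]setTI; exact: measurable_unconsp.
  rewrite /= /pushforward.
  rewrite [X in M X](_ : _ = F k)//.
  by apply/seteqP; split => x /=; rewrite conspK.
have [m2 m2E] := exists_sigma_finite_measure (measure0 m1)
  (@measure_ge0 _ _ _ m1) (@measure_semi_sigma_additive _ _ _ m1) sf.
by exists m2; rewrite m2E lebesgue_tupleS -mE.
Qed.

Let lt0 n : @lebesgue_tuple R n set0 = 0.
Proof. by have [m <-] := lebesgue_tuple_sigma_finite_measure n. Qed.

Let lt_ge0 n A : 0 <= @lebesgue_tuple R n A.
Proof. by have [m <-] := lebesgue_tuple_sigma_finite_measure n. Qed.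

Let lt_additive n : semi_sigma_additive (@lebesgue_tuple R n).
Proof.
have [m <-] := lebesgue_tuple_sigma_finite_measure n.
exact: measure_semi_sigma_additive.
Qed.

HB.instance Definition _ n := isMeasure.Build _ _ _ (@lebesgue_tuple R n)
  (lt0 n) (@lt_ge0 n) (@lt_additive n).

Let lt_sigma_finite n : sigma_finite setT (@lebesgue_tuple R n).
Proof.
have [m <-] := lebesgue_tuple_sigma_finite_measure n.
exact: sigma_finiteT.
Qed.

HB.instance Definition _ n :=
  Measure_isSigmaFinite.Build _ _ _ (@lebesgue_tuple R n) (@lt_sigma_finite n).

Lemma ge0_integral_lebesgue_tupleS n (f : n.+1.-tuple R -> \bar R) :
  measurable_fun setT f -> (forall x, 0 <= f x) ->
  \int[@lebesgue_tuple R n.+1]_x f x =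
  \int[@lebesgue_measure R]_x \int[@lebesgue_tuple R n]_y f (consp (x, y)).
Proof.
move=> mf f0; rewrite lebesgue_tupleS ge0_integral_pushforward//.
- rewrite preimage_setT fubini_tonelli1//; last by move=> x; exact: f0.
  exact: (measurableT_comp mf (@measurable_consp n)).
- exact: measurable_consp.
Qed.

Lemma measurable_tuple_box n (A : 'I_n -> set R) :
  (forall i, measurable (A i)) ->
  measurable [set x : n.-tuple R | forall i, A i (tnth x i)].
Proof.
move=> mA; rewrite [X in measurable X](_ : _ = \bigcap_(i in [set: 'I_n])
    ((fun x => tnth x i) @^-1` A i)); last first.
  by apply/seteqP; split => x /= Ax i => [_|]; exact: Ax.
apply: fin_bigcap_measurable => // i _.
by rewrite -[X in measurable X]setTI; exact: measurable_tnth.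
Qed.

Lemma lebesgue_tuple_prod n (A : 'I_n -> set R) : (forall i, measurable (A i)) ->
  @lebesgue_tuple R n [set x | forall i, A i (tnth x i)] =
  \prod_(i < n) @lebesgue_measure R (A i).
Proof.
elim: n A => [|n ih] A mA.
  rewrite big_ord0 /= diracE mem_set//= => -[]//.
rewrite big_ord_recl lebesgue_tupleS /pushforward.
rewrite [X in (_ \x _) X](_ : _ = A ord0 `*`
    [set x | forall i, A (lift ord0 i) (tnth x i)]); last first.
  apply/seteqP; split => -[x y] /=.
    move=> Axy; split; first exact: (Axy ord0).
    by move=> i; have := Axy (lift ord0 i); rewrite tnth_consp_lift.
  move=> [Ax Ay] i.
  have [<-|i0] := eqVneq ord0 i; first exact: Ax.
  have [j -> _] := unlift_some (i0 : ord0 != i).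
  by rewrite tnth_consp_lift; exact: Ay.
rewrite product_measure1E; [|exact: mA|by apply: (@measurable_tuple_box n (fun i => A (lift ord0 i)))].
by congr (_ * _); apply: ih.
Qed.

End lebesgue_tuple_measure.

(** * Comparing measures along an exhausting sequence *)

Section measure_cover.
Local Open Scope ereal_scope.
Context d (T : measurableType d) (R : realType).
Variables m1 m2 : {measure set T -> \bar R}.

(** By continuity from below; this reduces identities between sigma-finite measures to sets of
    finite measure. *)
Lemma eq_measure_ndcover (F : (set T)^nat) A :
  (forall n, measurable (F n)) ->
  (forall m n, (m <= n)%N -> F m `<=` F n) ->
  \bigcup_n F n = setT -> measurable A ->
  (forall n, m1 (A `&` F n) = m2 (A `&` F n)) -> m1 A = m2 A.
Proof.
move=> mF ndF FT mA m12.
have AE : \bigcup_n (A `&` F n) = A by rewrite -setI_bigcupr FT setIT.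
have mAF n : measurable (A `&` F n) by exact: measurableI.
have mU : measurable (\bigcup_n (A `&` F n)) by exact: bigcupT_measurable.
have nd : nondecreasing_seq (fun n => A `&` F n).
  by move=> m n mn; rewrite subsetEset; apply: setIS; exact: ndF.
have h1 := @nondecreasing_cvg_mu _ _ _ m1 _ mAF mU nd.
have h2 := @nondecreasing_cvg_mu _ _ _ m2 _ mAF mU nd.
rewrite AE in h1 h2.
rewrite -(cvg_lim _ h1)// -(cvg_lim _ h2)//; congr (limn _).
by apply/funext => n /=; exact: m12.
Qed.

End measure_cover.

Lemma eseries_setT {R : realType} (f : nat -> \bar R) :
  (\sum_(i <oo | i \in [set: nat]) f i = \sum_(i <oo) f i)%E.
Proof.
by congr (limn _); apply/funext => n; apply: eq_bigl => i; rewrite in_setT.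
Qed.

(** * Moments of the Poisson distribution *)

Section poisson_moments.
Local Open Scope ereal_scope.
Context {R : realType}.
Implicit Type l : R.

(** One formula for all rates: at rate 0 the distribution is the Dirac mass at 0, and [0 ^+ 0 = 1]
    makes the formula agree with it. *)
Lemma poisson_prob1 l k : (0 <= l)%R ->
  poisson_prob l k [set k] = (l ^+ k * k`!%:R^-1 * expR (- l))%:E.
Proof.
rewrite le_eqVlt => /orP[/eqP <-|l0].
  rewrite /poisson_prob ltxx diracE oppr0 expR0 mulr1.
  case: k => [|k]; first by rewrite mem_set//= expr0 mul1r fact0 invr1.
  by rewrite memNset//= expr0n/= mul0r.
rewrite /poisson_prob l0 esum_set1 ?lee_fin ?poisson_pmf_ge0//.
by rewrite /poisson_pmf l0.
Qed.

Let p l k : R := (l ^+ k * k`!%:R^-1 * expR (- l))%R.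

Let p_ge0 l k : (0 <= l)%R -> (0 <= p l k)%R.
Proof. by move=> l0; rewrite !mulr_ge0 ?exprn_ge0 ?invr_ge0 ?expR_ge0. Qed.

(** Shifting the index trades a factor [k] in a moment for a factor [l], so each moment series
    reduces to series of lower order. *)
Let pS l k : (k.+1%:R * p l k.+1 = l * p l k)%R.
Proof.
rewrite /p factS natrM exprS invfM.
have a0 : (k.+1%:R != 0 :> R)%R by rewrite pnatr_eq0.
have b0 : (k`!%:R != 0 :> R)%R by rewrite pnatr_eq0 -lt0n fact_gt0.
by move: (k.+1%:R : R)%R a0 => a a0; field; rewrite ?a0 ?b0.
Qed.

Lemma poisson_sum0 l : (0 <= l)%R -> \sum_(k <oo) poisson_prob l k [set k] = 1.
Proof.
move=> l0; rewrite -[RHS](@probability_setT _ _ _ (poisson_prob l 0%N)).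
have -> : [set: nat] = \bigcup_k [set k].
  by apply/seteqP; split => // k _; exists k.
rewrite measure_bigcup//=; last by move=> i j _ _ [x []] /= -> ->.
by rewrite eseries_setT.
Qed.

Lemma poisson_sum1 l : (0 <= l)%R ->
  \sum_(k <oo) k%:R%:E * poisson_prob l k [set k] = l%:E.
Proof.
move=> l0; rewrite nneseries_recl//; last first.
  by move=> k; rewrite poisson_prob1// -EFinM lee_fin mulr_ge0// p_ge0.
rewrite mul0e add0e -[RHS]mule1 -[in RHS](poisson_sum0 l0) -nneseriesZl//.
rewrite -nneseries_addn; last first.
  by move=> k; rewrite poisson_prob1// -EFinM lee_fin mulr_ge0// p_ge0.
apply: eq_eseriesr => k _; rewrite addn1 !poisson_prob1// -!EFinM.
by congr EFin; exact: pS.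
Qed.

Lemma poisson_sum2 l : (0 <= l)%R ->
  \sum_(k <oo) (k%:R ^+ 2)%:E * poisson_prob l k [set k] = (l ^+ 2 + l)%:E.
Proof.
move=> l0; rewrite nneseries_recl//; last first.
  by move=> k _; rewrite poisson_prob1// -EFinM lee_fin mulr_ge0// p_ge0.
rewrite expr0n/= mul0e add0e -nneseries_addn; last first.
  by move=> k; rewrite poisson_prob1// -EFinM lee_fin mulr_ge0// p_ge0.
(* One factor [k.+1] is absorbed by the shift [pS]; the other is split as [k + 1]. *)
transitivity (l%:E * \sum_(k <oo) (k%:R%:E * poisson_prob l k [set k]
    + poisson_prob l k [set k])).
  rewrite -nneseriesZl//; last first.
    move=> k _; rewrite poisson_prob1// -EFinM -EFinD lee_fin.
    by apply: addr_ge0; [apply: mulr_ge0 => //|]; exact: p_ge0.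
  apply: eq_eseriesr => k _; rewrite addn1 !poisson_prob1// -!EFinM.
  congr EFin; rewrite -/(p l k) -/(p l k.+1) expr2 -mulrA pS -natr1; ring.
rewrite nneseriesD//; last first.
  by move=> k _ _; rewrite poisson_prob1// -EFinM lee_fin mulr_ge0// p_ge0.
rewrite poisson_sum1// poisson_sum0// -EFinD -EFinM; congr EFin; ring.
Qed.

End poisson_moments.

(** * Integrals of functions of a natural-valued random variable *)

Section natural_valued.
Local Open Scope ereal_scope.
Context d (T : measurableType d) (R : realType) (P : probability T R).

(** The events [N w = k] are disjoint and of total probability one, so the integral splits over
    them; the values outside the naturals, [+oo] included, occur on a negligible set. *)
Lemma integral_natural_valued (N : T -> \bar R) (phi : \bar R -> \bar R) :
  measurable_fun setT N -> measurable_fun setT (phi \o N) ->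
  (forall x, 0 <= phi x) -> \sum_(k <oo) P [set w | N w = k%:R%:E] = 1 ->
  \int[P]_w phi (N w) = \sum_(k <oo) phi k%:R%:E * P [set w | N w = k%:R%:E].
Proof.
move=> mN mphi phi0 N1.
pose F k := [set w | N w = k%:R%:E].
have mF k : measurable (F k).
  rewrite (_ : F k = N @^-1` [set k%:R%:E])//.
  by rewrite -[X in measurable X]setTI; apply: mN => //; exact: emeasurable_set1.
have tF : trivIset setT F.
  move=> i j _ _ [w [/= Ni]]; rewrite /F/= Ni => -[] /eqP; rewrite eqr_nat => /eqP//.
have PU : P (\bigcup_k F k) = 1.
  by rewrite measure_bigcup//= eseries_setT.
have mU : measurable (\bigcup_k F k) by exact: bigcupT_measurable.
have PC : P (~` \bigcup_k F k) = 0.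
  by rewrite probability_setC// PU subee.
rewrite (@ge0_negligible_integral _ _ _ P setT (~` \bigcup_k F k))//; last first.
  exact: measurableC.
rewrite setTD setCK ge0_integral_bigcup//; last exact: measurable_funTS.
apply: eq_eseriesr => k _.
rewrite (eq_integral (fun=> phi k%:R%:E)); last first.
  by move=> w; rewrite inE /F/= => ->.
by rewrite integral_cst.
Qed.

End natural_valued.

(** * First and second moments of sums over a Poisson process *)

Section poisson_point_process.
Local Open Scope ereal_scope.
Context dT dE (T : measurableType dT) (E : measurableType dE) (R : realType).
Variables (P : probability T R) (mu : {sigma_finite_measure set E -> \bar R}).
Variable X : nat -> T -> E.
Hypothesis mX : forall i, measurable_fun setT (X i).
Hypothesis hX : forall A k, measurable A -> mu A < +oo ->
  P [set w | point_measure R X w A = k%:R%:E] = poisson_prob (fine (mu A)) k [set k].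

(** The integral of [h] against the random counting measure of the points. *)
Definition psum (h : E -> \bar R) (w : T) : \bar R := \sum_(i <oo) h (X i w).

Lemma psum_ge0 h w : (forall x, 0 <= h x) -> 0 <= psum h w.
Proof. by move=> h0; apply: nneseries_ge0. Qed.

Lemma le_psum g h w : (forall x, 0 <= g x) -> (forall i, g (X i w) <= h (X i w)) ->
  psum g w <= psum h w.
Proof. by move=> g0 gh; apply: lee_nneseries => //. Qed.

Lemma psumD g h w : (forall x, 0 <= g x) -> (forall x, 0 <= h x) ->
  psum (fun x => g x + h x) w = psum g w + psum h w.
Proof. by move=> g0 h0; rewrite /psum nneseriesD. Qed.

Lemma psumZ (c : R) h w : (forall x, 0 <= h x) ->
  psum (fun x => c%:E * h x) w = c%:E * psum h w.
Proof. by move=> h0; rewrite /psum nneseriesZl. Qed.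

Lemma measurable_psum h : measurable_fun setT h -> (forall x, 0 <= h x) ->
  measurable_fun setT (psum h).
Proof.
move=> mh h0; apply: ge0_emeasurable_sum => // i _.
exact: measurableT_comp.
Qed.

Let ind (A : set E) : E -> \bar R := fun x => (\1_A x)%:E.

Let ind_ge0 A x : 0 <= ind A x. Proof. by rewrite lee_fin. Qed.

Let mind A : measurable A -> measurable_fun setT (ind A).
Proof. by move=> mA; apply/measurable_EFinP; exact: measurable_indic. Qed.

Section finite_sets.
Variable A : set E.
Hypotheses (mA : measurable A) (Aoo : mu A < +oo).

Let N := psum (ind A).

Let mN : measurable_fun setT N. Proof. by apply: measurable_psum => //; exact: mind. Qed.

(** The counting measure of [A] unfolds to the sum of its indicator over the points, so the
    hypothesis applies by conversion. *)
Let PN k : P [set w | N w = k%:R%:E] = poisson_prob (fine (mu A)) k [set k].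
Proof. exact: hX. Qed.

Let fA : (fine (mu A))%:E = mu A.
Proof. by rewrite fineK// ge0_fin_numE. Qed.

Let fA0 : (0 <= fine (mu A))%R. Proof. exact: fine_ge0. Qed.

Let N1 : \sum_(k <oo) P [set w | N w = k%:R%:E] = 1.
Proof. by rewrite (eq_eseriesr (fun k _ => PN k)) poisson_sum0. Qed.

Lemma void_probability :
  P [set w | psum (ind A) w = 0] = (expR (- fine (mu A)))%:E.
Proof. by rewrite (PN 0%N) poisson_prob1// expr0 fact0 invr1 !mul1r. Qed.

Lemma expectation_count : \int[P]_w psum (ind A) w = mu A.
Proof.
(* The absolute value makes the test function nonnegative on all of the extended reals; it is the
   identity on counts. *)
have := @integral_natural_valued _ _ _ P N (fun x => `|x|) mN.
rewrite (eq_integral N); last by move=> w _; rewrite gee0_abs// psum_ge0.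
have mabsN : measurable_fun setT (abse \o N).
  by apply: measurableT_comp mN; exact: abse_measurable.
move=> ->//.
rewrite (eq_eseriesr (g := fun k => k%:R%:E *
  poisson_prob (fine (mu A)) k [set k])); last first.
  by move=> k _; rewrite PN gee0_abs// lee_fin.
by rewrite poisson_sum1// fA.
Qed.

Lemma second_moment_count :
  \int[P]_w (psum (ind A) w * psum (ind A) w) = mu A * mu A + mu A.
Proof.
have := @integral_natural_valued _ _ _ P N (fun x => `|x| * `|x|) mN.
rewrite (eq_integral (fun w => N w * N w)); last first.
  by move=> w _; rewrite gee0_abs// psum_ge0.
have mabsN : measurable_fun setT (abse \o N).
  by apply: measurableT_comp mN; exact: abse_measurable.
move=> ->//; last exact: (emeasurable_funM mabsN mabsN).
rewrite (eq_eseriesr (g := fun k => (k%:R ^+ 2)%:E *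
  poisson_prob (fine (mu A)) k [set k])); last first.
  by move=> k _; rewrite PN gee0_abs ?lee_fin// -EFinM.
by rewrite poisson_sum2// EFinD expr2 EFinM fA.
Qed.

End finite_sets.

(** A finite factor comes out of the inner series. If [psum h w] is infinite, either all [g (X i w)]
    vanish and both sides are zero, or a single positive one makes both sides infinite. *)
Let psum_mul g h w : (forall x, 0 <= g x) -> (forall x, 0 <= h x) ->
  (forall x, g x \is a fin_num) ->
  \sum_(i <oo) \sum_(j <oo) (g (X i w) * h (X j w)) = psum g w * psum h w.
Proof.
move=> g0 h0 gf; rewrite (eq_eseriesr (g := fun i => g (X i w) * psum h w)).
  have := psum_ge0 w h0; case: (psum h w) => [r r0|_|//].
    by rewrite muleC -nneseriesZl//; apply: eq_eseriesr => i _; rewrite muleC.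
  have [g00|] := eqVneq (psum g w) 0.
    rewrite g00 mul0e; apply: eseries0 => i _ _.
    suff -> : g (X i w) = 0 by rewrite mul0e.
    apply/eqP; rewrite eq_le g0 andbT -g00.
    rewrite /psum (@nneseriesD1 _ _ i)// leeDl//.
    by apply: nneseries_ge0.
  rewrite neq_lt ltNge psum_ge0//= => gpos.
  rewrite gt0_muley//.
  have [i gi] : exists i, 0 < g (X i w).
    apply: contrapT => /forallNP gn; move: gpos; rewrite /psum eseries0 ?ltxx//.
    move=> i _ _; apply/eqP; rewrite eq_le g0 andbT leNgt; exact/negP/gn.
  apply/eqP; rewrite -leye_eq (@nneseriesD1 _ _ i)//; last first.
    by move=> k _; exact: mule_ge0.
  rewrite gt0_muley// addye ?leye_eq// gt_eqF// (lt_le_trans (ltNyr 0))//.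
  by apply: nneseries_ge0 => k _ _; exact: mule_ge0.
move=> i _; rewrite -[g (X i w)]fineK// -nneseriesZl//.
Qed.

Let mXX i j : measurable_fun setT (fun w => (X i w, X j w)).
Proof. exact: measurable_fun_pair. Qed.

(** The sum of the laws of the points is the mean measure of the process; [M2], built from the laws
    of pairs of points, is its second moment measure. *)
Let M1 : {measure set E -> \bar R} :=
  mseries (fun i => pushforward_measure P (mX i)) 0.

Let M2 : {measure set (E * E)%type -> \bar R} :=
  mseries (fun i => mseries (fun j => pushforward_measure P (mXX i j)) 0
    : {measure set (E * E)%type -> \bar R}) 0.

Let integral_M1 h : measurable_fun setT h -> (forall x, 0 <= h x) ->
  \int[M1]_x h x = \int[P]_w psum h w.
Proof.
move=> mh h0; rewrite ge0_integral_measure_series// integral_nneseries//; last first.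
  by move=> i; exact: measurableT_comp.
apply: eq_eseriesr => i _.
by rewrite ge0_integral_pushforward// preimage_setT.
Qed.

Let integral_M2 g h : measurable_fun setT g -> (forall x, 0 <= g x) ->
  measurable_fun setT h -> (forall x, 0 <= h x) ->
  (forall x, g x \is a fin_num) ->
  \int[M2]_z (g z.1 * h z.2) = \int[P]_w (psum g w * psum h w).
Proof.
move=> mg g0 mh h0 gf.
have mgh : measurable_fun setT (fun z : E * E => g z.1 * h z.2).
  by apply: emeasurable_funM; exact: measurableT_comp.
have mghX i j : measurable_fun setT (fun w => g (X i w) * h (X j w)).
  by apply: emeasurable_funM; exact: measurableT_comp.
have gh0 z : 0 <= g z.1 * h z.2 by exact: mule_ge0.
rewrite ge0_integral_measure_series//.
under eq_integral do rewrite -psum_mul//.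
rewrite integral_nneseries//; first last.
- by move=> i w _; apply: nneseries_ge0 => j _ _; exact: mule_ge0.
- by move=> i; apply: ge0_emeasurable_sum => // j w _ _; exact: mule_ge0.
apply: eq_eseriesr => i _.
rewrite ge0_integral_measure_series// integral_nneseries//; last first.
  by move=> j w _; exact: mule_ge0.
apply: eq_eseriesr => j _.
by rewrite ge0_integral_pushforward// preimage_setT.
Qed.

Let F : (set E)^nat := 
  sval (cid ((sigma_finiteP setT mu).1 (sigma_finiteT mu))).

Let FT : \bigcup_n F n = setT.
Proof. by rewrite /F; case: cid => /= G []. Qed.

Let ndF m n : (m <= n)%N -> F m `<=` F n.
Proof. by rewrite /F; case: cid => /= G [_ + _] mn => /(_ _ _ mn)/subsetPset. Qed.

Let mF n : measurable (F n).
Proof. by rewrite /F; case: cid => /= G [_ _ /(_ n)[]]. Qed.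

Let Foo n : mu (F n) < +oo.
Proof. by rewrite /F; case: cid => /= G [_ _ /(_ n)[]]. Qed.

Let AFoo A n : measurable A -> mu (A `&` F n) < +oo.
Proof.
move=> mA; apply: le_lt_trans (Foo n).
by apply: le_measure; rewrite ?inE//; exact: measurableI.
Qed.

(** On sets of finite intensity both sides are the mean of a Poisson count; the cover [F] reaches
    the other sets. *)
Let M1E A : measurable A -> M1 A = mu A.
Proof.
move=> mA; apply: (@eq_measure_ndcover _ _ _ _ _ F) => // n.
have mAF : measurable (A `&` F n) by exact: measurableI.
rewrite -[RHS](expectation_count mAF)//; last exact: AFoo.
rewrite -integral_M1//; last exact: mind.
by rewrite integral_indic// setIT.
Qed.

(** Campbell's formula: the mean measure is the intensity. *)
Lemma expectation_psum h : measurable_fun setT h -> (forall x, 0 <= h x) ->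
  \int[P]_w psum h w = \int[mu]_x h x.
Proof.
move=> mh h0; rewrite -integral_M1//; apply: eq_measure_integral => A mA _.
exact: M1E.
Qed.

(* Opaque, since unfolding this integral during conversion is very slow. *)
Let EN_sig : {EN : set E -> set E -> \bar R |
  forall A B, EN A B = \int[P]_w (psum (ind A) w * psum (ind B) w)}.
Proof. by exists (fun A B => \int[P]_w (psum (ind A) w * psum (ind B) w)). Qed.

Let EN := sval EN_sig.

Let ENE0 A B : EN A B = \int[P]_w (psum (ind A) w * psum (ind B) w).
Proof. exact: (svalP EN_sig). Qed.

Let EN_diag A : measurable A -> mu A < +oo -> EN A A = mu A * mu A + mu A.
Proof. by move=> mA Aoo; rewrite ENE0 second_moment_count. Qed.

Let indU A B x : A `&` B = set0 -> ind (A `|` B) x = ind A x + ind B x.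
Proof.
move=> AB; rewrite /ind -EFinD !indicE in_setU; congr EFin.
have [xA|xA] := boolP (x \in A); have [xB|xB] := boolP (x \in B);
  rewrite /= ?addr0 ?add0r//.
have : (A `&` B) x by split; apply: set_mem.
by rewrite AB.
Qed.

Let psumU A B w : A `&` B = set0 ->
  psum (ind (A `|` B)) w = psum (ind A) w + psum (ind B) w.
Proof.
move=> AB; rewrite -psumD//; congr psum; apply/funext => x; exact: indU.
Qed.

Let mEN A B : measurable A -> measurable B ->
  measurable_fun setT (fun w => psum (ind A) w * psum (ind B) w).
Proof.
by move=> mA mB; apply: emeasurable_funM; apply: measurable_psum => //; exact: mind.
Qed.

Let EN_ge0 A B w : 0 <= psum (ind A) w * psum (ind B) w.
Proof. by apply: mule_ge0; exact: psum_ge0. Qed.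

Let ENC A B : EN A B = EN B A.
Proof. by rewrite !ENE0; apply: eq_integral => w _; rewrite muleC. Qed.

Let ENDl A B C : measurable A -> measurable B -> measurable C ->
  A `&` B = set0 -> EN (A `|` B) C = EN A C + EN B C.
Proof.
move=> mA mB mC AB; rewrite !ENE0 -ge0_integralD//; try exact: mEN.
apply: eq_integral => w _; rewrite psumU// ge0_muleDl//; exact: psum_ge0.
Qed.

(* By polarization, because the count of [A `|` B] is Poisson distributed too. *)
Let EN_disj A B : measurable A -> measurable B -> mu A < +oo -> mu B < +oo ->
  A `&` B = set0 -> EN A B = mu A * mu B.
Proof.
move=> mA mB Aoo Boo AB.
have mAB : measurable (A `|` B) by exact: measurableU.
have ABE : mu (A `|` B) = mu A + mu B by rewrite measureU.
have ABoo : mu (A `|` B) < +oo by rewrite ABE lte_add_pinfty.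
have := EN_diag mAB ABoo.
rewrite ENDl// ENC ENDl// [EN B (A `|` B)]ENC ENDl//.
rewrite [EN B A]ENC !EN_diag// ABE.
have ENoo : EN A B <= mu (A `|` B) * mu (A `|` B) + mu (A `|` B).
  rewrite -EN_diag// !ENE0; apply: ge0_le_integral => //; try exact: mEN.
  move=> w _; rewrite psumU//; apply: lee_pmul; try exact: psum_ge0.
    by rewrite leeDl// psum_ge0.
  by rewrite leeDr// psum_ge0.
have : EN A B \is a fin_num.
  rewrite ge0_fin_numE; last by rewrite ENE0; apply: integral_ge0 => w _; exact: EN_ge0.
  apply: le_lt_trans ENoo _; rewrite lte_add_pinfty// lte_mul_pinfty//.
  by rewrite ge0_fin_numE.
have finA : mu A \is a fin_num by rewrite ge0_fin_numE.
have finB : mu B \is a fin_num by rewrite ge0_fin_numE.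
rewrite -(fineK finA) -(fineK finB).
move: (EN A B) => [e||]// _; move: (fine (mu A)) (fine (mu B)) => a b.
rewrite -!(EFinM, EFinD) => -[] H; congr EFin.
by move: H; lra.
Qed.

(** Splitting both sets along their intersection leaves disjoint pairs, whose mixed moments factor,
    and one diagonal pair, whose second moment supplies the extra mass of the intersection. *)
Let ENE A B : measurable A -> measurable B -> mu A < +oo -> mu B < +oo ->
  EN A B = mu A * mu B + mu (A `&` B).
Proof.
move=> mA mB Aoo Boo.
have mI : measurable (A `&` B) by exact: measurableI.
have mD : measurable (A `\` B) by exact: measurableD.
have mD' : measurable (B `\` A) by exact: measurableD.
have Ioo : mu (A `&` B) < +oo.
  by apply: le_lt_trans Aoo; apply: le_measure; rewrite ?inE.
have Doo : mu (A `\` B) < +oo.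
  by apply: le_lt_trans Aoo; apply: le_measure; rewrite ?inE.
have D'oo : mu (B `\` A) < +oo.
  by apply: le_lt_trans Boo; apply: le_measure; rewrite ?inE.
have AE : A = (A `&` B) `|` (A `\` B) by rewrite setUIDK.
have BE : B = (A `&` B) `|` (B `\` A) by rewrite [A `&` B]setIC setUIDK.
have d1 : (A `&` B) `&` (A `\` B) = set0.
  by apply/seteqP; split => x //= [[_ ?] [_]].
have d2 : (A `&` B) `&` (B `\` A) = set0.
  by apply/seteqP; split => x //= [[? _] [_]].
have d3 : (A `\` B) `&` (B `\` A) = set0.
  by apply/seteqP; split => x //= [[? _] [_]].
have muA : mu A = mu (A `&` B) + mu (A `\` B) by rewrite {1}AE measureU.
have muB : mu B = mu (A `&` B) + mu (B `\` A) by rewrite {1}BE measureU.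
have EB C : measurable C -> EN C B = EN C (A `&` B) + EN C (B `\` A).
  move=> mC; transitivity (EN ((A `&` B) `|` (B `\` A)) C).
    by rewrite -BE; exact: ENC.
  by rewrite ENDl//; congr (_ + _); exact: ENC.
have -> : EN A B = EN (A `&` B) B + EN (A `\` B) B by rewrite {1}AE ENDl.
rewrite !EB// [EN (A `\` B) (A `&` B)]ENC.
rewrite EN_diag// !EN_disj// muA muB.
have finI : mu (A `&` B) \is a fin_num by rewrite ge0_fin_numE.
have finD : mu (A `\` B) \is a fin_num by rewrite ge0_fin_numE.
have finD' : mu (B `\` A) \is a fin_num by rewrite ge0_fin_numE.
rewrite -(fineK finI) -(fineK finD) -(fineK finD').
by rewrite -!(EFinM, EFinD); congr EFin; ring.
Qed.

Let mdiag : measurable_fun setT (fun x : E => (x, x)).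
Proof. exact: measurable_fun_pair. Qed.

(** The second summand accounts for the pairs made of a point and itself. *)
Let M3 : {measure set (E * E)%type -> \bar R} :=
  measure_add (mu \x mu) (pushforward_measure mu mdiag).

Let M3E Z : M3 Z = (mu \x mu) Z + mu [set x | Z (x, x)].
Proof. exact: measure_addE. Qed.

Let M2E_fin A B : measurable A -> measurable B -> mu A < +oo -> mu B < +oo ->
  M2 (A `*` B) = M3 (A `*` B).
Proof.
move=> mA mB Aoo Boo.
have -> : M3 (A `*` B) = mu A * mu B + mu (A `&` B).
  by rewrite M3E product_measure1E.
rewrite -ENE// ENE0 -integral_M2//; [|exact: mind|exact: mind].
rewrite (eq_integral (EFin \o \1_(A `*` B))).
  by rewrite integral_indic ?setIT//; exact: measurableX.
move=> z _; rewrite /ind/= -EFinM !indicE; congr EFin.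
by rewrite -natrM mulnb; congr (nat_of_bool _)%:R; rewrite in_setX.
Qed.

(** The rectangles form a pi-system generating the product sigma-algebra. Agreement on those with
    sides of finite intensity passes to all of them along the squares of [F], and then to all
    measurable sets by uniqueness. *)
Let M2E Z : measurable Z -> M2 Z = M3 Z.
Proof.
pose C : set (set (E * E)) :=
  [set A `*` B | A in measurable & B in measurable].
have FFT : \bigcup_n (F n `*` F n) = [set: E * E].
  apply/seteqP; split => // -[x y] _.
  have [n _ Fx] : (\bigcup_n F n) x by rewrite FT.
  have [m _ Fy] : (\bigcup_n F n) y by rewrite FT.
  exists (maxn n m) => //; split => /=.
    by apply: ndF Fx; rewrite leq_maxl.
  by apply: ndF Fy; rewrite leq_maxr.
move=> mZ; apply: (measure_unique C (fun n => F n `*` F n)) => //.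
- exact: measurable_prod_measurableType.
- move=> _ _ [A mA [B mB <-]] [A' mA' [B' mB' <-]]; rewrite -setXI.
  exists (A `&` A'); first exact: measurableI.
  by exists (B `&` B') => //; exact: measurableI.
- by move=> n; exists (F n) => //; exists (F n).
- move=> _ [A mA [B mB <-]].
  apply: (@eq_measure_ndcover _ _ _ _ _ (fun n => F n `*` F n)) => //.
  + by move=> n; exact: measurableX.
  + by move=> m n mn; apply: setSX; exact: ndF.
  + exact: measurableX.
  + move=> n; rewrite -setXI; apply: M2E_fin; try exact: measurableI.
      exact: AFoo.
    exact: AFoo.
- move=> n; rewrite [ltLHS](M2E_fin (mF n) (mF n))//.
  rewrite M3E product_measure1E// lte_add_pinfty//.
    by rewrite lte_mul_pinfty// ?ge0_fin_numE//; exact: Foo.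
  rewrite (_ : [set x | _] = F n); first exact: Foo.
  by apply/seteqP; split => x // [].
Qed.

(** Tonelli on the product part gives the squared mean; a change of variables on the diagonal part
    gives the integral of the square. *)
Lemma second_moment_psum h : measurable_fun setT h -> (forall x, 0 <= h x) ->
  (forall x, h x \is a fin_num) ->
  \int[P]_w (psum h w * psum h w) =
  \int[mu]_x h x * \int[mu]_x h x + \int[mu]_x (h x * h x).
Proof.
move=> mh h0 hf; rewrite -integral_M2//.
rewrite (eq_measure_integral M3); last by move=> Z mZ _; exact: M2E.
have mhh : measurable_fun setT (fun z : E * E => h z.1 * h z.2).
  by apply: emeasurable_funM; exact: measurableT_comp.
have hh0 z : 0 <= h z.1 * h z.2 by exact: mule_ge0.
rewrite ge0_integral_measure_add//; congr (_ + _).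
  rewrite fubini_tonelli1// /fubini_F/=.
  under eq_integral do rewrite ge0_integralZl//.
  by rewrite ge0_integralZr// integral_ge0.
by rewrite ge0_integral_pushforward// preimage_setT.
Qed.

End poisson_point_process.

(** * Markov and Chebyshev inequalities *)

Section poisson_deviations.
Local Open Scope ereal_scope.
Context dT dE (T : measurableType dT) (E : measurableType dE) (R : realType).
Variables (P : probability T R) (mu : {sigma_finite_measure set E -> \bar R}).
Variable X : nat -> T -> E.
Hypothesis mX : forall i, measurable_fun setT (X i).
Hypothesis hX : forall A k, measurable A -> mu A < +oo ->
  P [set w | point_measure R X w A = k%:R%:E] = poisson_prob (fine (mu A)) k [set k].

Lemma markov_le (A : set T) (G : T -> \bar R) (c : R) (v : \bar R) :
  measurable A -> measurable_fun setT G -> (forall w, 0 <= G w) ->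
  (0 < c)%R -> (forall w, A w -> c%:E <= G w) -> \int[P]_w G w <= v ->
  P A <= c^-1%:E * v.
Proof.
move=> mA mG G0 c0 AG Gv.
rewrite lee_pdivlMl// (le_trans _ Gv)//.
rewrite -(integral_cst P mA c%:E)//.
apply: (@le_trans _ _ (\int[P]_(w in A) G w)); last first.
  by apply: ge0_subset_integral => //; rewrite setTI.
apply: ge0_le_integral => //; last exact: measurable_funTS.
by move=> w _; rewrite lee_fin ltW.
Qed.

Variable h : E -> R.
Hypotheses (mh : measurable_fun setT h) (h0 : forall x, (0 <= h x)%R).

Let S := psum X (EFin \o h).

Let mS : measurable_fun setT S.
Proof.
by apply: measurable_psum => //; exact/measurable_EFinP.
Qed.

Let S0 w : 0 <= S w.
Proof. by apply: psum_ge0 => x; rewrite lee_fin. Qed.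

Let ES : \int[P]_w S w = \int[mu]_x (h x)%:E.
Proof.
rewrite (expectation_psum mX hX)//; exact/measurable_EFinP.
Qed.

Let ESS : \int[P]_w (S w * S w) = \int[mu]_x (h x)%:E * \int[mu]_x (h x)%:E
  + \int[mu]_x (h x ^+ 2)%:E.
Proof.
rewrite (second_moment_psum mX hX)//; exact/measurable_EFinP.
Qed.

Let mSS : measurable_fun setT (fun w => S w * S w).
Proof. exact: emeasurable_funM. Qed.

Lemma measurable_psum_ge (c : \bar R) : measurable [set w | c <= S w].
Proof. by rewrite -[X in measurable X]setTI; exact: emeasurable_fun_c_infty. Qed.

Lemma measurable_psum_le (c : \bar R) : measurable [set w | S w <= c].
Proof. by rewrite -[X in measurable X]setTI; exact: emeasurable_fun_infty_c. Qed.

Lemma psum_markov (m a : R) : (0 < a)%R -> \int[mu]_x (h x)%:E <= m%:E ->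
  P [set w | a%:E <= S w] <= (m / a)%:E.
Proof.
move=> a0 hm; rewrite mulrC EFinM; apply: (@markov_le _ S) => //.
  exact: measurable_psum_ge.
by rewrite ES.
Qed.

(** Markov's inequality for the squared sum: upper bounds on the two integrals suffice, and the
    bound decays like the inverse square of [a]. *)
Lemma psum_markov2 (m v a : R) : (0 < a)%R -> (0 <= m)%R ->
  \int[mu]_x (h x)%:E <= m%:E -> \int[mu]_x (h x ^+ 2)%:E <= v%:E ->
  P [set w | a%:E <= S w] <= ((m ^+ 2 + v) / a ^+ 2)%:E.
Proof.
move=> a0 m0 hm hv; rewrite mulrC EFinM.
apply: (@markov_le _ (fun w => S w * S w)) => //.
- exact: measurable_psum_ge.
- by move=> w; exact: mule_ge0.
- by rewrite exprn_gt0.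
- by move=> w /= aS; rewrite expr2 EFinM lee_pmul// lee_fin ltW.
- rewrite ESS EFinD expr2 EFinM leeD// lee_pmul//.
    by apply: integral_ge0 => x _; rewrite lee_fin.
  by apply: integral_ge0 => x _; rewrite lee_fin.
Qed.

Lemma psum_chebyshev (m v a : R) : (0 < a)%R ->
  \int[mu]_x (h x)%:E = m%:E -> \int[mu]_x (h x ^+ 2)%:E <= v%:E ->
  P [set w | S w <= (m - a)%:E \/ (m + a)%:E <= S w] <= (v / a ^+ 2)%:E.
Proof.
move=> a0 hm hv.
set A := [set w | _].
have mA : measurable A.
  apply: measurableU; [exact: measurable_psum_le|exact: measurable_psum_ge].
have m0 : (0 <= m)%R.
  by rewrite -lee_fin -hm; apply: integral_ge0 => x _; rewrite lee_fin.
have aP : \int[P]_w ((a ^+ 2)%:E * (\1_A w)%:E) = (a ^+ 2)%:E * P A.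
  rewrite ge0_integralZl ?integral_indic ?setIT//.
    by apply/measurable_EFinP; exact: measurable_indic.
  by rewrite lee_fin exprn_ge0// ltW.
have mSP : \int[P]_w ((2 * m)%:E * S w) = (2 * m ^+ 2)%:E.
  rewrite ge0_integralZl//; last by rewrite lee_fin mulr_ge0.
  by rewrite ES hm -EFinM; congr EFin; ring.
have maA : measurable_fun setT (fun w => (a ^+ 2)%:E * (\1_A w)%:E).
  apply: emeasurable_funM => //.
  by apply/measurable_EFinP; exact: measurable_indic.
have mmS : measurable_fun setT (fun w => (2 * m)%:E * S w).
  exact: emeasurable_funM.
have a1A0 w : 0 <= (a ^+ 2)%:E * (\1_A w)%:E.
  by rewrite -EFinM lee_fin mulr_ge0// ?sqr_ge0.
have mS0 w : 0 <= (2 * m)%:E * S w.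
  by rewrite mule_ge0// lee_fin mulr_ge0.
have mSS0 w : 0 <= S w * S w by rewrite mule_ge0.
(* [a^2 1_A + 2 m S <= S^2 + m^2] needs no subtraction when [S] is infinite. *)
have key : \int[P]_w ((a ^+ 2)%:E * (\1_A w)%:E + (2 * m)%:E * S w) <=
    \int[P]_w (S w * S w + (m ^+ 2)%:E).
  apply: ge0_le_integral => //.
  - by move=> w _; rewrite adde_ge0.
  - exact: emeasurable_funD.
  - exact: emeasurable_funD.
  move=> w _; rewrite indicE; have [wA|_] := boolP (w \in A); last first.
    move: (S0 w); case: (S w) => [r r0||//].
      rewrite mule0 add0e -!EFinM -EFinD lee_fin.
      by have := sqr_ge0 (r - m)%R; lra.
    by rewrite mulyy addye ?leey.
  move: (S0 w) wA; rewrite inE /A/=; case: (S w) => [r r0||//]; last first.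
    by rewrite mulyy addye ?leey.
  rewrite mule1 => -[]; rewrite lee_fin => H; rewrite -!EFinM -!EFinD lee_fin.
    by suff : (a ^+ 2 <= (r - m) ^+ 2)%R; [lra|nra].
  by suff : (a ^+ 2 <= (r - m) ^+ 2)%R; [lra|nra].
move: key; rewrite !ge0_integralD//; last first.
  by move=> w _; rewrite lee_fin sqr_ge0.
have mP : \int[P]_w (m ^+ 2)%:E = (m ^+ 2)%:E.
  have /= -> := integral_cst P measurableT (m ^+ 2)%:E.
  by rewrite [X in _ * X]probability_setT mule1.
rewrite aP mSP ESS hm mP => key.
rewrite mulrC EFinM lee_pdivlMl ?exprn_gt0//.
(* The term [2 * m ^+ 2] is finite and hence cancels. *)
have : (a ^+ 2)%:E * P A + (2 * m ^+ 2)%:E <= v%:E + (2 * m ^+ 2)%:E.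
  apply: (le_trans key); rewrite -EFinM addeAC -EFinD addeC leeD//.
  by rewrite lee_fin; lra.
by rewrite leeD2rE.
Qed.

End poisson_deviations.

(** * The Borel-Cantelli lemma *)

Lemma borel_cantelli_ae d (T : measurableType d) (R : realType)
    (P : probability T R) (F : (set T)^nat) :
  (forall n, measurable (F n)) -> (\sum_(n <oo) P (F n) < +oo)%E ->
  {ae P, forall w, exists N, forall n, (N <= n)%N -> ~ F n w}.
Proof.
move=> mF Foo; exists (lim_sup_set F); split.
- apply: bigcapT_measurable => n; apply: bigcup_measurable => k _; exact: mF.
- exact: lim_sup_set_cvg0.
- move=> w /= nw N _; apply: contrapT => nF; apply: nw; exists N => n Nn Fn.
  by apply: nF; exists n.
Qed.

(** * Pointwise estimates of the heat kernel *)

Section heat_kernel_estimates.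
Context {R : realType} (d : nat).
Implicit Types (s u : R) (y : d.-tuple R).

(** The peak in dimension one; its [d]-th power is the normalising factor in dimension [d], with a
    natural exponent in place of a real one. *)
Definition heat_peak s : R := (Num.sqrt (4 * pi * s))^-1.

Lemma heat_peak_gt0 s : 0 < s -> 0 < heat_peak s.
Proof. by move=> s0; rewrite invr_gt0 sqrtr_gt0 !mulr_gt0// pi_gt0. Qed.

Lemma heat_peak_ge0 s : 0 <= heat_peak s.
Proof. by rewrite invr_ge0 sqrtr_ge0. Qed.

Lemma heat_peak_sqr s : 0 < s -> heat_peak s ^+ 2 = (4 * pi * s)^-1.
Proof.
move=> s0; rewrite exprVn sqr_sqrtr//.
by rewrite ltW// !mulr_gt0// pi_gt0.
Qed.

Lemma heat_kernelE s y : 0 < s ->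
  heat_kernel s y = heat_peak s ^+ d * expR (- (enorm y ^+ 2 / (4 * s))).
Proof.
move=> s0; rewrite /heat_kernel s0; congr (_ * _).
have a0 : 0 <= 4 * pi * s by rewrite ltW// !mulr_gt0// pi_gt0.
rewrite /heat_peak; move: (4 * pi * s) a0 => a a0.
rewrite powRN mulrC powRrM powR12_sqrt// powR_mulrn ?sqrtr_ge0// exprVn//.
Qed.

Lemma heat_kernel_ge0 s y : 0 <= heat_kernel s y.
Proof.
by rewrite /heat_kernel; case: ifPn => // _; rewrite mulr_ge0 ?powR_ge0 ?expR_ge0.
Qed.

Lemma enorm_sqr y : enorm y ^+ 2 = \sum_(i < d) tnth y i ^+ 2.
Proof. by rewrite sqr_sqrtr// sumr_ge0// => i _; rewrite sqr_ge0. Qed.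

(** Peaks are inverse square roots, so they are compared through their squares. *)
Let le_of_sqr (a b : R) : 0 <= a -> 0 <= b -> a ^+ 2 <= b ^+ 2 -> a <= b.
Proof. by move=> a0 b0; rewrite ler_sqr. Qed.

Let le_expn (a b : R) : 0 <= a -> a <= b -> a ^+ d <= b ^+ d.
Proof. by move=> a0 ab; apply: lerXn2r => //; rewrite nnegrE (le_trans a0). Qed.

Let ratio_peak_sqr s u : 0 < s -> 0 < u ->
  (u / s) ^+ 2 * (4 * pi * u)^-1 = (u / s) * (4 * pi * s)^-1.
Proof.
move=> /lt0r_neq0 s0 /lt0r_neq0 u0; have /lt0r_neq0 := pi_gt0 R.
by move: pi => p p0; field; rewrite ?s0 ?u0 ?p0.
Qed.

Let four_peak_sqr u : 0 < u -> 2 ^+ 2 * (4 * pi * u)^-1 = (pi * u)^-1 :> R.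
Proof.
move=> /lt0r_neq0 u0; have /lt0r_neq0 := pi_gt0 R.
by move: pi => p p0; field; rewrite ?u0 ?p0.
Qed.

(** The squared peak is at most [1 / s], hence at most [c ^+ 2], and the exponential is at most
    one. *)
Lemma heat_kernel_ub s y (c : R) : 0 < s -> 0 <= c -> 1 <= s * c ^+ 2 ->
  heat_kernel s y <= c ^+ d.
Proof.
move=> s0 c0 sc; rewrite heat_kernelE// -[leRHS]mulr1.
have pi2 := pi_ge2 R.
apply: ler_pM; rewrite ?exprn_ge0 ?heat_peak_ge0 ?expR_ge0//.
  apply: le_expn; first exact: heat_peak_ge0.
  apply: le_of_sqr => //; first exact: heat_peak_ge0.
  rewrite heat_peak_sqr// -div1r ler_pdivrMr ?mulr_gt0 ?pi_gt0//.
  nra.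
by rewrite -[leRHS]expR0 ler_expR oppr_le0 divr_ge0 ?sqr_ge0// mulr_ge0// ltW.
Qed.

(** The exponential factor increases with time, and up to time [4 * s] the peak loses at most a
    factor 2 per dimension. *)
Lemma heat_kernel_later s u y : 0 < s -> s <= u -> u <= 4 * s ->
  heat_kernel s y <= 2 ^+ d * heat_kernel u y.
Proof.
move=> s0 su us; have u0 : 0 < u by exact: lt_le_trans su.
have p0 := pi_gt0 R.
rewrite !heat_kernelE// mulrA -exprMn.
apply: ler_pM; rewrite ?exprn_ge0 ?heat_peak_ge0 ?expR_ge0//.
  apply: le_expn; first exact: heat_peak_ge0.
  apply: le_of_sqr; rewrite ?mulr_ge0 ?heat_peak_ge0//.
  rewrite exprMn !heat_peak_sqr//.
  rewrite four_peak_sqr//.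
  by rewrite lef_pV2 ?posrE ?mulr_gt0//; nra.
rewrite ler_expR lerN2; apply: ler_pM.
- exact: sqr_ge0.
- by rewrite invr_ge0 mulr_ge0// ltW.
- by [].
- by rewrite lef_pV2 ?posrE ?mulr_gt0// ler_pM2l.
Qed.

(** The peaks have ratio the square root of [u / s], which is at least [u / s] because [u <= s]. *)
Lemma heat_kernel_earlier s u y : 0 < u -> u <= s ->
  (u / s) ^+ d * heat_kernel u y <= heat_kernel s y.
Proof.
move=> u0 us; have s0 : 0 < s by exact: lt_le_trans us.
have p0 := pi_gt0 R.
have us0 : 0 < u / s by rewrite divr_gt0.
have us1 : u / s <= 1 by rewrite ler_pdivrMr// mul1r.
rewrite !heat_kernelE// mulrA -exprMn.
have uh0 : 0 <= u / s * heat_peak u by apply: mulr_ge0; rewrite ?heat_peak_ge0// ltW.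
apply: ler_pM; rewrite ?expR_ge0//; first exact: exprn_ge0.
  apply: le_expn => //; apply: le_of_sqr => //; first exact: heat_peak_ge0.
  rewrite exprMn !heat_peak_sqr//.
  rewrite ratio_peak_sqr//.
  by rewrite ler_piMl// invr_ge0 ltW// !mulr_gt0.
rewrite ler_expR lerN2; apply: ler_pM.
- exact: sqr_ge0.
- by rewrite invr_ge0 mulr_ge0// ltW.
- by [].
- by rewrite lef_pV2 ?posrE ?mulr_gt0// ler_pM2l.
Qed.

(** At a fixed point the kernel increases until the squared distance divided by [2 * d]. Here, with
    [r = u / s], the peaks lose at most [r ^+ d <= expR (d * (r - 1))], and the exponent gains at
    least [d * (r - 1)]. *)
Lemma heat_kernel_far s u y : 0 < s -> s <= u -> 4 * d%:R * u <= enorm y ^+ 2 ->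
  heat_kernel s y <= heat_kernel u y.
Proof.
move=> s0 su yu; have u0 : 0 < u by exact: lt_le_trans su.
have p0 := pi_gt0 R.
have us1 : 1 <= u / s by rewrite ler_pdivlMr// mul1r.
rewrite !heat_kernelE//.
have qq : heat_peak s <= (u / s) * heat_peak u.
  apply: le_of_sqr; first exact: heat_peak_ge0.
    by apply: mulr_ge0; rewrite ?heat_peak_ge0// (le_trans ler01 us1).
  rewrite exprMn !heat_peak_sqr//.
  rewrite ratio_peak_sqr//.
  by rewrite ler_peMl// invr_ge0 ltW// !mulr_gt0.
have rr : u / s <= expR (u / s - 1).
  by apply: le_trans (expR_ge1Dx _); lra.
apply: (@le_trans _ _ ((expR (u / s - 1) * heat_peak u) ^+ d *
    expR (- (enorm y ^+ 2 / (4 * s))))).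
  rewrite ler_pM2r ?expR_gt0//; apply: le_expn; first exact: heat_peak_ge0.
  by apply: (le_trans qq); rewrite ler_pM2r// heat_peak_gt0.
rewrite exprMn mulrAC mulrC ler_pM2l ?exprn_gt0 ?heat_peak_gt0//.
rewrite -expRM_natl -expRD ler_expR.
have -> : enorm y ^+ 2 / (4 * s) = enorm y ^+ 2 / (4 * u) * (u / s).
  by field; rewrite !gt_eqF.
have yd : d%:R <= enorm y ^+ 2 / (4 * u).
  by rewrite ler_pdivlMr ?mulr_gt0// mulrCA mulrA.
move: (u / s) us1 => r us1; move: (_ / _) yd => e yd.
rewrite -mulr_natl; nra.
Qed.

(** By scaling, the peak at time [r ^+ 2] is [heat_peak 1 / r]; the exponent is at most [d / 4],
    bounded here by [d]. *)
Lemma heat_kernel_near (r : R) y : 0 < r -> enorm y ^+ 2 <= d%:R * r ^+ 2 ->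
  heat_peak 1 ^+ d * expR (- d%:R) * r ^- d <= heat_kernel (r ^+ 2) y.
Proof.
move=> r0 yr; have r20 : 0 < r ^+ 2 by rewrite exprn_gt0.
have p0 := pi_gt0 R.
rewrite heat_kernelE//.
have -> : heat_peak (r ^+ 2) = heat_peak 1 / r.
  rewrite /heat_peak mulr1 sqrtrM; last by rewrite mulr_ge0// ltW.
  by rewrite sqrtr_sqr gtr0_norm// invfM.
rewrite exprMn -exprVn mulrAC ler_pM2l; last first.
  by rewrite mulr_gt0// exprn_gt0 ?heat_peak_gt0 ?invr_gt0.
rewrite ler_expR lerN2 ler_pdivrMr ?mulr_gt0//.
have := mulr_ge0 (ler0n R d) (ltW r20); rewrite mulrCA; lra.
Qed.

End heat_kernel_estimates.

(** * Measurability and total mass of the heat kernel *)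

Section heat_kernel_integral.
Context {R : realType}.

Lemma enorm_consp d (p : measurableTypeR R * d.-tuple R) :
  enorm (consp p) ^+ 2 = p.1 ^+ 2 + enorm p.2 ^+ 2.
Proof.
rewrite !enorm_sqr big_ord_recl tnth_consp0; congr (_ + _).
by apply: eq_bigr => i _; rewrite tnth_consp_lift.
Qed.

Lemma measurable_enorm_sqr d :
  measurable_fun setT (fun y : d.-tuple R => enorm y ^+ 2).
Proof.
rewrite (_ : (fun _ => _) = fun y => \sum_(i < d) tnth y i ^+ 2); last first.
  by apply/funext => y; rewrite enorm_sqr.
apply: measurable_sum => i; apply: measurable_funX; exact: measurable_tnth.
Qed.

Lemma measurable_heat_kernel d (s : R) :
  measurable_fun setT (fun y : d.-tuple R => heat_kernel s y).
Proof.
have [s0|s0] := ltP 0 s; last first.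
  rewrite (_ : (fun _ => _) = cst 0)//; apply/funext => y.
  by rewrite /heat_kernel ltNge s0.
rewrite (_ : (fun _ => _) = fun y : d.-tuple R =>
  heat_peak s ^+ d * expR (- (enorm y ^+ 2 / (4 * s)))); last first.
  by apply/funext => y; rewrite heat_kernelE.
apply: measurable_funM => //; apply: measurableT_comp => //.
apply: measurableT_comp => //; apply: measurable_funM => //.
exact: measurable_enorm_sqr.
Qed.

Lemma measurable_heat_kernel_time d (c : R) : measurable_fun setT
  (fun z : measurableTypeR R * d.-tuple R => heat_kernel (c - z.1) z.2).
Proof.
have mt : measurable_fun setT (fun z : measurableTypeR R * d.-tuple R => c - z.1 : R).
  exact: measurable_funB.
have mz : measurable_fun setT
    (fun z : measurableTypeR R * d.-tuple R => enorm z.2 ^+ 2).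
  exact: (measurableT_comp (@measurable_enorm_sqr d)).
(* Division by the elapsed time is rewritten as a real power, a measurable function that agrees with
   it at positive times. *)
rewrite (_ : (fun _ => _) = fun z : measurableTypeR R * d.-tuple R =>
  if 0 < c - z.1 then (4 * pi * (c - z.1)) `^ (- (d%:R / 2)) *
    expR (- (enorm z.2 ^+ 2 * (4 * (c - z.1)) `^ (-1))) else 0); last first.
  apply/funext => z; rewrite /heat_kernel; case: ifPn => // z0.
  by rewrite powR_inv1// mulr_ge0// ltW.
apply: measurable_fun_if => //.
  exact: measurable_fun_ltr.
apply: measurable_funTS; apply: measurable_funM.
  apply: (measurableT_comp (measurable_powR _)).
  exact: measurable_funM.
apply: measurableT_comp => //; apply: measurableT_comp => //.
apply: measurable_funM => //.
apply: (measurableT_comp (measurable_powR _)).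
exact: measurable_funM.
Qed.

(** By induction on the dimension: the kernel is the centred normal density of variance [2 * s] in
    the first coordinate times the kernel in the remaining ones. *)
Lemma integral_heat_kernel d (s : R) : 0 < s ->
  (\int[@lebesgue_tuple R d]_y (heat_kernel s y)%:E = 1)%E.
Proof.
move=> s0; elim: d => [|d ih].
  rewrite [LHS]integral_dirac//; last first.
    by apply/measurable_EFinP; exact: measurable_heat_kernel.
  rewrite diracE in_setT mul1e heat_kernelE// expr0 mul1r enorm_sqr big_ord0.
  by rewrite mul0r oppr0 expR0.
rewrite ge0_integral_lebesgue_tupleS; first last.
- by move=> y; rewrite lee_fin heat_kernel_ge0.
- by apply/measurable_EFinP; exact: measurable_heat_kernel.
pose sg := Num.sqrt (2 * s).
have sg0 : sg != 0 by rewrite gt_eqF// sqrtr_gt0 mulr_gt0.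
have sg2 : sg ^+ 2 = 2 * s by rewrite sqr_sqrtr// mulr_ge0// ltW.
rewrite -[RHS](integral_normal_pdf (0 : R) sg).
apply: eq_integral => x _.
transitivity (\int[@lebesgue_tuple R d]_y
    ((normal_pdf 0 sg x)%:E * (heat_kernel s y)%:E))%E.
  apply: eq_integral => y _; rewrite -EFinM; congr EFin.
  rewrite !heat_kernelE// enorm_consp/= normal_pdfE// /normal_peak /normal_fun.
  rewrite sg2 subr0 exprS mulrDl opprD expRD.
  have -> : heat_peak s = (Num.sqrt (2 * s * pi *+ 2))^-1.
    by rewrite /heat_peak; congr (Num.sqrt _)^-1; rewrite -mulr_natr; ring.
  have -> : - (x ^+ 2 / (4 * s)) = - x ^+ 2 / (2 * s *+ 2).
    by rewrite mulNr -mulr_natr; congr (- (_ / _)); ring.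
  ring.
rewrite ge0_integralZl//.
- by rewrite ih mule1.
- by apply/measurable_EFinP; exact: measurable_heat_kernel.
- by move=> y _; rewrite lee_fin heat_kernel_ge0.
- by rewrite lee_fin normal_pdf_ge0.
Qed.

End heat_kernel_integral.

(** * The space-time intensity and integrals of the kernel *)

Section space_time.
Context {R : realType} (d : nat).
Local Open Scope ereal_scope.
Local Notation ST := (measurableTypeR R * d.-tuple R)%type.

Lemma integral_indic_itv (a b : R) : (a <= b)%R ->
  \int[@lebesgue_measure R]_t (\1_(`[a, b[%classic : set R) t)%:E = (b - a)%:E.
Proof.
move=> ab; rewrite integral_indic//= setIT lebesgue_measure_itv/= lte_fin.
move: ab; rewrite le_eqVlt => /orP[/eqP ->|->]; last by rewrite EFinB.
by rewrite ltxx subrr.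
Qed.

Lemma exists_space_time_measure :
  exists mu : {sigma_finite_measure set ST -> \bar R},
    mu = @lebesgue_space_time R d :> (set _ -> _).
Proof.
have mD : measurable (`[0%R, +oo[%classic `*` setT : set ST).
  by apply: measurableX.
pose L : {measure set ST -> \bar R} := @lebesgue_measure R \x @lebesgue_tuple R d.
pose m : {measure set ST -> \bar R} := mrestr L mD.
have sf : sigma_finite setT m.
  have [F TF Foo] :=
    product_measure_sigma_finite (@lebesgue_measure R) (@lebesgue_tuple R d).
  exists F => // k; have [mF Fk] := Foo k; split=> //.
  apply: le_lt_trans Fk; rewrite /m/= /mrestr; apply: le_measure; rewrite ?inE//.
  exact: measurableI.
have [m2 m2E] := exists_sigma_finite_measure (measure0 m)
  (@measure_ge0 _ _ _ m) (@measure_semi_sigma_additive _ _ _ m) sf.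
by exists m2; rewrite m2E.
Qed.

Variable mu : {sigma_finite_measure set ST -> \bar R}.
Hypothesis muE : mu = @lebesgue_space_time R d :> (set _ -> _).

Lemma space_time_rect (A : set R) (B : set (d.-tuple R)) :
  measurable A -> measurable B -> (forall t, A t -> (0 <= t)%R) ->
  mu (A `*` B) = @lebesgue_measure R A * @lebesgue_tuple R d B.
Proof.
move=> mA mB A0; rewrite muE /lebesgue_space_time.
rewrite [X in (_ \x _) X](_ : _ = A `*` B) ?product_measure1E//.
apply/seteqP; split => [z []//|z [/= Az Bz]]; do 2 split => //=.
by rewrite in_itv/= andbT; exact: A0.
Qed.

(** An integrand that vanishes at negative times does not see the restriction of the intensity, so
    Tonelli for the full product applies. *)
Lemma integral_space_time (h : ST -> \bar R) :
  measurable_fun setT h -> (forall z, 0 <= h z) ->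
  (forall z, (z.1 < 0)%R -> h z = 0) ->
  \int[mu]_z h z = \int[@lebesgue_measure R]_t \int[@lebesgue_tuple R d]_y h (t, y).
Proof.
move=> mh h0 hneg.
pose D : set ST := `[0%R, +oo[%classic `*` setT.
have hD : h = h \_ D.
  apply/funext => z; rewrite patchE; case: ifPn => // /negP zD.
  apply: hneg; rewrite ltNge; apply/negP => z0; apply: zD.
  by rewrite inE; split => //=; rewrite in_itv/= z0.
pose L : {measure set ST -> \bar R} := @lebesgue_measure R \x @lebesgue_tuple R d.
transitivity (\int[mu]_(z in D) h z).
  by rewrite [RHS]integral_mkcond -hD.
rewrite (eq_measure_integral L); last first.
  move=> A mA AD; transitivity (@lebesgue_space_time R d A); first by rewrite -muE.
  rewrite /lebesgue_space_time; congr (_ _).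
  by apply/seteqP; split => [z []//|z Az]; split => //; exact: AD.
rewrite integral_mkcond -hD.
by rewrite /L fubini_tonelli1.
Qed.

(** The contribution at the origin of a point arriving in [[a, b[]. The evaluation time [u] is
    separate from the window, so old points can be observed later. *)
Definition heat_window (a b u : R) (z : ST) : R :=
  (\1_(`[a, b[%classic : set R) z.1 * heat_kernel (u - z.1) z.2)%R.

Lemma heat_window_ge0 a b u z : (0 <= heat_window a b u z)%R.
Proof. by rewrite mulr_ge0// heat_kernel_ge0. Qed.

Lemma measurable_indic_time (A : set R) : measurable A ->
  measurable_fun setT (fun z : ST => \1_A z.1 : R).
Proof.
move=> mA; apply: (measurableT_comp (f := \1_A : measurableTypeR R -> R)) => //.
Qed.

Lemma measurable_heat_window a b u : measurable_fun setT (heat_window a b u).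
Proof.
apply: measurable_funM; first exact: measurable_indic_time.
exact: measurable_heat_kernel_time.
Qed.

(** The kernel has spatial mass one at every time of the window; the open right end keeps the
    elapsed time positive even when [b = u]. *)
Lemma integral_heat_window (a b u : R) : (0 <= a)%R -> (a <= b)%R -> (b <= u)%R ->
  \int[mu]_z (heat_window a b u z)%:E = (b - a)%:E.
Proof.
move=> a0 ab bu; rewrite integral_space_time; first last.
- move=> z z0; rewrite /heat_window indicE memNset ?mul0r//= in_itv/=.
  by move=> /andP[az _]; move: (le_lt_trans az z0); rewrite ltNge a0.
- by move=> z; rewrite lee_fin heat_window_ge0.
- by apply/measurable_EFinP; exact: measurable_heat_window.
transitivity (\int[@lebesgue_measure R]_t (\1_(`[a, b[%classic : set R) t)%:E).
  apply: eq_integral => t _; rewrite /heat_window/= indicE.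
  have [|_] := boolP (t \in _); last by under eq_integral do rewrite mul0r; rewrite integral0.
  rewrite inE/= in_itv/= => /andP[at_ tb]; under eq_integral do rewrite mul1r.
  by rewrite integral_heat_kernel// subr_gt0 (lt_le_trans tb).
exact: integral_indic_itv.
Qed.

(** When the elapsed time is at least one the kernel is at most one, so it dominates its square. *)
Lemma integral_heat_window_sqr (a b u : R) : (0 <= a)%R -> (a <= b)%R ->
  (b + 1 <= u)%R -> \int[mu]_z (heat_window a b u z ^+ 2)%:E <= (b - a)%:E.
Proof.
move=> a0 ab bu; rewrite -(@integral_heat_window a b u)//; last first.
  by apply: le_trans bu; rewrite lerDl.
have mw := measurable_heat_window a b u.
apply: ge0_le_integral => //.
- by move=> z _; rewrite lee_fin sqr_ge0.
- by apply/measurable_EFinP; exact: measurable_funX.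
- exact/measurable_EFinP.
move=> z _; rewrite lee_fin expr2 ler_piMl ?heat_window_ge0//.
rewrite /heat_window indicE; have [|_] := boolP (z.1 \in _); last by rewrite mul0r.
rewrite inE/= in_itv/= => /andP[_ zb]; rewrite mul1r.
rewrite -[leRHS](expr1n _ d); apply: heat_kernel_ub => //; nra.
Qed.

Lemma integral_heat_product (a b s : R) : (0 <= a)%R -> (a <= b)%R -> (0 < s)%R ->
  \int[mu]_z (\1_(`[a, b[%classic : set R) z.1 * heat_kernel s z.2)%:E = (b - a)%:E.
Proof.
move=> a0 ab s0; rewrite integral_space_time; first last.
- move=> z z0; rewrite indicE memNset ?mul0r//= in_itv/=.
  by move=> /andP[az _]; move: (le_lt_trans az z0); rewrite ltNge a0.
- by move=> z; rewrite lee_fin mulr_ge0// heat_kernel_ge0.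
- apply/measurable_EFinP; apply: measurable_funM; first exact: measurable_indic_time.
  by apply: (measurableT_comp (@measurable_heat_kernel _ d s)).
transitivity (\int[@lebesgue_measure R]_t (\1_(`[a, b[%classic : set R) t)%:E).
  apply: eq_integral => t _.
  transitivity (\int[@lebesgue_tuple R d]_y
    ((\1_(`[a, b[%classic : set R) t)%:E * (heat_kernel s y)%:E)) => //.
  rewrite ge0_integralZl//.
  - by rewrite integral_heat_kernel// mule1.
  - by apply/measurable_EFinP; exact: measurable_heat_kernel.
  - by move=> y _; rewrite lee_fin heat_kernel_ge0.
exact: integral_indic_itv.
Qed.

End space_time.

(** * The solution at the origin as a sum over the noise points *)

Section mild_solution_as_sum.
Context {R : realType} (d : nat).
Local Open Scope ereal_scope.
Local Notation ST := (measurableTypeR R * d.-tuple R)%type.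
Context dT (T : measurableType dT) (P : probability T R).
Variables (tau : nat -> T -> R) (eta : nat -> T -> d.-tuple R).

Definition noise_point (i : nat) (w : T) : ST := (tau i w, eta i w).

(** The kernel is even in space and vanishes at nonpositive times, which removes the reflection and
    the indicator. *)
Lemma mild_solution0E (t : R) w : mild_solution0 tau eta t w =
  psum noise_point (fun z => (heat_kernel (t - z.1) z.2)%:E) w.
Proof.
apply: eq_eseriesr => i _ /=; congr EFin.
have -> : heat_kernel (t - tau i w) (tuple_sub [tuple 0%R | _ < d] (eta i w)) =
    heat_kernel (t - tau i w) (eta i w).
  have ne : enorm (tuple_sub [tuple 0%R | _ < d] (eta i w)) = enorm (eta i w).
    congr Num.sqrt; apply: eq_bigr => j _.
    by rewrite !tnth_mktuple sub0r sqrrN.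
  by rewrite /heat_kernel ne.
case: ifPn => [_|]; first by rewrite mulr1.
by rewrite -leNgt mulr0 /heat_kernel subr_gt0 ltNge => ->.
Qed.

Hypothesis hnoise : is_standard_poisson_noise P tau eta.

Lemma noise_time_ge0 i w : (0 <= tau i w)%R.
Proof. by case: hnoise. Qed.

Lemma measurable_noise_point i : measurable_fun setT (noise_point i).
Proof. by case: hnoise => _ [mX _ _]; exact: mX. Qed.

Lemma noise_point_count (mu : {sigma_finite_measure set ST -> \bar R}) :
  mu = @lebesgue_space_time R d :> (set _ -> _) ->
  forall A k, measurable A -> mu A < +oo ->
  P [set w | point_measure R noise_point w A = k%:R%:E] =
  poisson_prob (fine (mu A)) k [set k].
Proof. by move=> -> A k mA Aoo; case: hnoise => _ [_ hX _]; exact: hX. Qed.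

End mild_solution_as_sum.

(** * Criteria for limits superior and inferior at infinity *)

Section limits_at_infinity.
Context {R : realType}.
Local Open Scope ereal_scope.
Implicit Type g : R -> \bar R.

Lemma limf_esup_le g (c : \bar R) (M : R) :
  (forall t, (M < t)%R -> g t <= c) -> limf_esup g (pinfty_nbhs R) <= c.
Proof.
move=> gc; rewrite limf_esupE; apply: (@le_trans _ _ (ereal_sup (g @` [set t | (M < t)%R]))).
  apply: ereal_inf_lbound; exists [set t | (M < t)%R] => //.
  by exists M; split; rewrite ?num_real.
by apply: ge_ereal_sup => _ [t Mt <-]; exact: gc.
Qed.

Lemma limf_esup_ge g (c : \bar R) :
  (forall M : R, exists2 t, (M < t)%R & c <= g t) ->
  c <= limf_esup g (pinfty_nbhs R).
Proof.
move=> gc; rewrite limf_esupE; apply: le_ereal_inf_tmp => _ [V [M [_ MV]] <-].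
have [t Mt ct] := gc M; apply: (le_trans ct); apply: ereal_sup_ubound.
by exists t => //; exact: MV.
Qed.

Lemma limf_einf_ge g (c : \bar R) (M : R) :
  (forall t, (M < t)%R -> c <= g t) -> c <= limf_einf g (pinfty_nbhs R).
Proof.
move=> gc; rewrite /limf_einf leeNr; apply: (@limf_esup_le _ _ M) => t Mt.
by rewrite leeN2; exact: gc.
Qed.

Lemma limf_einf_le g (c : \bar R) :
  (forall M : R, exists2 t, (M < t)%R & g t <= c) ->
  limf_einf g (pinfty_nbhs R) <= c.
Proof.
move=> gc; rewrite /limf_einf leeNl; apply: limf_esup_ge => M.
by have [t Mt gt] := gc M; exists t => //; rewrite leeN2.
Qed.

End limits_at_infinity.

(** * Elementary bounds on series *)

Section series.
Context {R : realType}.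

Lemma sum_inv_sqr_le n : \sum_(k < n) (k.+1%:R ^- 2 : R) <= 2.
Proof.
(* The sharper bound is inductive: [2 / x - 2 / (x + 1)] is at least [x ^- 2] for [x >= 1]. *)
suff : \sum_(k < n) (k.+1%:R ^- 2 : R) <= 2 - 2 / n.+1%:R.
  by move=> H; apply: (le_trans H); rewrite gerBl divr_ge0.
elim: n => [|n ih]; first by rewrite big_ord0 divr1 subrr.
rewrite big_ord_recr/=; apply: (le_trans (lerD ih (lexx _))).
rewrite -[n.+2%:R]natr1; have : 1 <= (n.+1%:R : R) by rewrite ler1n.
move: (n.+1%:R : R) => x x1.
have x0 : 0 < x by lra.
have x10 : 0 < x + 1 by lra.
rewrite -subr_ge0.
have -> : 2 - 2 / (x + 1) - (2 - 2 / x + x ^- 2) = (x - 1) / (x ^+ 2 * (x + 1)).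
  by field; rewrite !gt_eqF.
by rewrite divr_ge0 ?subr_ge0// mulr_ge0 ?sqr_ge0// ltW.
Qed.

Lemma nneseries_le_bound (u : (\bar R)^nat) (b : nat -> R) (M : R) :
  (forall n, 0 <= u n)%E -> (forall n, u n <= (b n)%:E)%E ->
  (forall n, \sum_(k < n) b k <= M) -> (\sum_(n <oo) u n <= M%:E)%E.
Proof.
move=> u0 ub bM; apply: lime_le; first exact: is_cvg_nneseries.
apply: nearW => n; rewrite big_mkord.
apply: (@le_trans _ _ (\sum_(k < n) (b k)%:E)%E); first exact: lee_sum.
by rewrite sumEFin lee_fin.
Qed.

Lemma bernoulli_le (x : R) n : 0 <= x -> x <= 1 -> 1 - n%:R * x <= (1 - x) ^+ n.
Proof.
move=> x0 x1; elim: n => [|n ih]; first by rewrite mul0r subr0 expr0.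
rewrite exprS; apply: (@le_trans _ _ ((1 - x) * (1 - n%:R * x))).
  rewrite -natr1; have : (0 : R) <= n%:R by []. 
  nra.
by rewrite ler_wpM2l// subr_ge0.
Qed.

End series.

Lemma borel_cantelli_bound d (T : measurableType d) (R : realType)
    (P : probability T R) (F : (set T)^nat) (b : nat -> R) (M : R) :
  (forall n, measurable (F n)) -> (forall n, P (F n) <= (b n)%:E)%E ->
  (forall n, \sum_(k < n) b k <= M) ->
  {ae P, forall w, exists N, forall n, (N <= n)%N -> ~ F n w}.
Proof.
move=> mF Fb bM; apply: borel_cantelli_ae => //.
by apply: le_lt_trans (nneseries_le_bound _ Fb bM) _ => //; rewrite ltry.
Qed.

(** * The integral test for the reciprocal of [f] *)

Section integral_test.
Context {R : realType}.
Local Open Scope ereal_scope.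
Variable f : R -> R.
Hypothesis f_gt0 : forall t : R, (0 < t)%R -> (0 < f t)%R.
Hypothesis f_ndecr : forall s t : R, (0 < s)%R -> (s <= t)%R -> (f s <= f t)%R.

Let I k : set R := `[k.+1%:R, k.+2%:R[%classic.

Let mI k : measurable (I k : set R). Proof. exact: measurable_itv. Qed.

Let mI' k : measurable (I k : set (measurableTypeR R)).
Proof. exact: mI. Qed.

Let IT : \bigcup_k I k = `[1%R, +oo[%classic.
Proof.
apply/seteqP; split => [t [k _]|t] /=; rewrite /I/= !in_itv/= ?andbT.
  by move=> /andP[kt _]; apply: le_trans kt; rewrite ler1n.
move=> t1; have t0 : (0 <= t)%R by exact: le_trans t1.
have := truncn_itv t0; set n := Num.truncn t => /andP[nt tn].
have n0 : (0 < n)%N.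
  by rewrite lt0n; apply/eqP => n0; move: tn; rewrite n0 ltNge t1.
exists n.-1 => //=; rewrite /I/= in_itv/= prednK// nt.
exact: tn.
Qed.

Let tI : trivIset setT I.
Proof.
apply/trivIsetP => i j _ _ ij; apply/seteqP; split => // t [].
rewrite /I/= !in_itv/= => /andP[it ti] /andP[jt tj].
have : (i.+1%:R < j.+2%:R :> R)%R by exact: le_lt_trans tj.
have : (j.+1%:R < i.+2%:R :> R)%R by exact: le_lt_trans ti.
rewrite !ltr_nat !ltnS => ji ij'; move: ij; rewrite neq_ltn => /orP[]; lia.
Qed.

(** The hypotheses say nothing of [f] at nonpositive arguments; extending its reciprocal by a
    constant below 1 gives a nonincreasing, hence measurable, function on the line. *)
Let g (t : R) : R := if (1 <= t)%R then (f t)^-1%R else (f 1)^-1%R.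

Let mg : measurable_fun setT g.
Proof.
apply: nonincreasing_measurable => // s t st; rewrite /g.
have f1 := f_gt0 ltr01.
have [s1|s1] := leP 1%R s; have [t1|t1] := leP 1%R t => //.
- have s0 : (0 < s)%R by exact: lt_le_trans s1.
  rewrite lef_pV2 ?posrE ?f_gt0 ?f_ndecr//; exact: lt_le_trans st.
- by move: (le_lt_trans st t1); rewrite ltNge s1.
- rewrite lef_pV2 ?posrE ?f_gt0 ?f_ndecr//; exact: lt_le_trans t1.
Qed.

Let g_ge0 t : 0 <= (g t)%:E.
Proof.
rewrite lee_fin /g; case: ifPn => t1; rewrite invr_ge0 ltW// f_gt0//.
exact: lt_le_trans t1.
Qed.

Let mgI k : measurable_fun (I k : set (measurableTypeR R)) (fun t => (g t)%:E).
Proof. by apply/measurable_EFinP; exact: measurable_funTS. Qed.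

Let integral_g : \int[@lebesgue_measure R]_(t in `[1%R, +oo[) ((f t)^-1)%:E =
  \sum_(k <oo) \int[@lebesgue_measure R]_(t in I k) (g t)%:E.
Proof.
rewrite -ge0_integral_bigcup//; last first.
  by rewrite IT; apply/measurable_EFinP; exact: measurable_funTS.
rewrite IT; apply: eq_integral => t; rewrite inE/= in_itv/= andbT => t1.
by rewrite /g t1.
Qed.

Let lebI k : @lebesgue_measure R (I k) = 1.
Proof.
rewrite /I lebesgue_measure_itv/= lte_fin ltr_nat ltnSn -EFinD.
by rewrite -[k.+2%:R]natr1 addrAC subrr add0r.
Qed.

(** By monotonicity the integral over [[k + 1, k + 2[] lies between the values at the ends; hence
    the index [k.+1] in the divergent case and [k.+2] in the convergent one. *)
Let gI_ub k : \int[@lebesgue_measure R]_(t in I k) (g t)%:E <= ((f k.+1%:R)^-1)%:E.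
Proof.
rewrite -[leRHS]mule1 -(lebI k) -integral_cst//.
apply: ge0_le_integral => //.
move=> t; rewrite /I/= in_itv/= => /andP[kt _].
have k0 : (0 < k.+1%:R :> R)%R by [].
have t1 : (1 <= t)%R by apply: le_trans kt; rewrite ler1n.
rewrite lee_fin /g t1 lef_pV2 ?posrE ?f_gt0 ?f_ndecr//; exact: lt_le_trans t1.
Qed.

Let gI_lb k : ((f k.+2%:R)^-1)%:E <= \int[@lebesgue_measure R]_(t in I k) (g t)%:E.
Proof.
rewrite -[leLHS]mule1 -(lebI k) -integral_cst//.
apply: ge0_le_integral => //.
  by move=> t _; rewrite lee_fin invr_ge0 ltW// f_gt0.
move=> t; rewrite /I/= in_itv/= => /andP[kt tk].
have t1 : (1 <= t)%R by apply: le_trans kt; rewrite ler1n.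
have t0 : (0 < t)%R by exact: lt_le_trans t1.
by rewrite lee_fin /g t1 lef_pV2 ?posrE ?f_gt0 ?f_ndecr// ltW.
Qed.

Lemma sum_inv_bounded :
  \int[@lebesgue_measure R]_(t in `[1%R, +oo[) ((f t)^-1)%:E < +oo ->
  exists M : R, forall n, (\sum_(k < n) (f k.+2%:R)^-1 <= M)%R.
Proof.
rewrite integral_g => foo.
have f0 : \sum_(k <oo) \int[@lebesgue_measure R]_(t in I k) (g t)%:E \is a fin_num.
  by rewrite ge0_fin_numE//; apply: nneseries_ge0 => k _ _; exact: integral_ge0.
exists (fine (\sum_(k <oo) \int[@lebesgue_measure R]_(t in I k) (g t)%:E)) => n.
rewrite -lee_fin fineK// -sumEFin.
apply: (@le_trans _ _ (\sum_(k < n) \int[@lebesgue_measure R]_(t in I k) (g t)%:E)).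
  by apply: lee_sum => i _; exact: gI_lb.
rewrite -(big_mkord xpredT (fun k => \int[@lebesgue_measure R]_(t in I k) (g t)%:E)).
by apply: nneseries_lim_ge => k _ _; exact: integral_ge0.
Qed.

Lemma sum_inv_unbounded :
  \int[@lebesgue_measure R]_(t in `[1%R, +oo[) ((f t)^-1)%:E = +oo ->
  forall M : R, exists n, (M <= \sum_(k < n) (f k.+1%:R)^-1)%R.
Proof.
rewrite integral_g => foo M; apply: contrapT => /forallNP nM.
suff : \sum_(k <oo) \int[@lebesgue_measure R]_(t in I k) (g t)%:E <= M%:E.
  by rewrite foo leye_eq.
apply: (@nneseries_le_bound _ _ (fun k => (f k.+1%:R)^-1)%R) => //.
  by move=> k; exact: integral_ge0.
by move=> n; have /negP := nM n; rewrite -ltNge => /ltW.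
Qed.

End integral_test.

(** * Old and recent points; the limit inferior *)

Section stochastic_heat_equation.
Context {R : realType} (d : nat).
Local Notation ST := (measurableTypeR R * d.-tuple R)%type.
Context dT (T : measurableType dT) (P : probability T R).
Variables (tau : nat -> T -> R) (eta : nat -> T -> d.-tuple R).
Hypothesis hnoise : is_standard_poisson_noise P tau eta.
Variable mu : {sigma_finite_measure set ST -> \bar R}.
Hypothesis muE : mu = @lebesgue_space_time R d :> (set _ -> _).

Let X := noise_point tau eta.
Let mX := measurable_noise_point hnoise.
Let hX := noise_point_count hnoise muE.
Let Y := mild_solution0 tau eta.

Let YE t w : Y t w = psum X (fun z => (heat_kernel (t - z.1) z.2)%:E) w.
Proof. exact: mild_solution0E. Qed.

Lemma mild_solution0_ge0 t w : (0 <= mild_solution0 tau eta t w)%E.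
Proof.
rewrite -/(Y t w) YE; apply: psum_ge0 => z; rewrite lee_fin; exact: heat_kernel_ge0.
Qed.

Definition window_sum (a b u : R) (w : T) : \bar R :=
  psum X (EFin \o heat_window a b u) w.

Let kernel_split a t (z : ST) : 0 <= z.1 -> 0 <= a ->
  heat_kernel (t - z.1) z.2 = heat_window 0 a t z + heat_window a t t z.
Proof.
move=> z0 a0; rewrite /heat_window !indicE !mem_setE !in_itv/= z0/=.
have [zt|tz] := ltP z.1 t; last first.
  rewrite /heat_kernel subr_gt0 ltNge tz/=; ring.
by have [za|az] := ltP z.1 a; rewrite /= ?mul1r ?mul0r ?addr0 ?add0r.
Qed.

(** Separates the points older than [a], whose kernels are bounded when [a] is away from [t] and
    allow a variance estimate, from the recent ones, whose kernels need not be square integrable. *)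
Lemma mild_solution0_split a t w : 0 <= a ->
  Y t w = (window_sum 0 a t w + window_sum a t t w)%E.
Proof.
move=> a0; rewrite YE /window_sum -psumD; last 2 first.
- by move=> z; rewrite lee_fin heat_window_ge0.
- by move=> z; rewrite lee_fin heat_window_ge0.
apply: eq_eseriesr => i _; rewrite -EFinD; congr EFin.
by apply: kernel_split => //; exact: noise_time_ge0 hnoise i w.
Qed.

Lemma window_sum_chebyshev (a b u c : R) : 0 <= a -> a <= b -> b + 1 <= u -> 0 < c ->
  (P [set w | window_sum a b u w <= ((b - a) - c)%:E \/
              ((b - a) + c)%:E <= window_sum a b u w] <= ((b - a) / c ^+ 2)%:E)%E.
Proof.
move=> a0 ab bu c0; apply: (psum_chebyshev mX hX) => //.
- exact: measurable_heat_window.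
- by move=> z; exact: heat_window_ge0.
- apply: (integral_heat_window muE) => //; apply: le_trans bu; lra.
- exact: (integral_heat_window_sqr muE).
Qed.

Lemma window_sum_markov (a b u c : R) : 0 <= a -> a <= b -> b <= u -> 0 < c ->
  (P [set w | c%:E <= window_sum a b u w] <= ((b - a) / c)%:E)%E.
Proof.
move=> a0 ab bu c0; apply: (psum_markov mX hX) => //.
- exact: measurable_heat_window.
- by move=> z; exact: heat_window_ge0.
- by rewrite (integral_heat_window muE).
Qed.

Lemma measurable_window_sum a b u : measurable_fun setT (window_sum a b u).
Proof.
apply: measurable_psum; first exact: mX.
  by apply/measurable_EFinP; exact: measurable_heat_window.
by move=> z; rewrite lee_fin heat_window_ge0.
Qed.

Let mge a b u c : measurable [set w | (c <= window_sum a b u w)%E].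
Proof.
rewrite -[X in measurable X]setTI.
by apply: emeasurable_fun_c_infty => //; exact: measurable_window_sum.
Qed.

Let mle a b u c : measurable [set w | (window_sum a b u w <= c)%E].
Proof.
rewrite -[X in measurable X]setTI.
by apply: emeasurable_fun_infty_c => //; exact: measurable_window_sum.
Qed.

(** Sampling times sparse enough for bounds of order [1 / sq k] to be summable, yet with consecutive
    ratios tending to one. *)
Let sq (k : nat) : R := k.+1%:R ^+ 2.

Let sq_ge1 k : 1 <= sq k.
Proof. by rewrite /sq -[leLHS](expr1n _ 2) ler_sqr ?nnegrE// ler1n. Qed.

Let sum_sq (C : R) n : 0 <= C -> \sum_(k < n) C / sq k <= C * 2.
Proof. by move=> C0; rewrite -mulr_sumr ler_wpM2l//; exact: sum_inv_sqr_le. Qed.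

Let sq_unbounded (M : R) N : exists2 k, (N <= k)%N & M < sq k.
Proof.
exists (maxn N (Num.truncn M)); first by rewrite leq_maxl.
have := truncnS_gt M; move=> H; apply: (lt_le_trans H).
rewrite /sq; have : ((Num.truncn M).+1%:R : R) <= (maxn N (Num.truncn M)).+1%:R.
  by rewrite ler_nat ltnS leq_maxr.
move=> H2; apply: (le_trans H2); rewrite expr2 ler_peMr// ler1n//.
Qed.

Section liminf.
Variable e : R.
Hypotheses (e0 : 0 < e) (e1 : e < 1).

(** The points older than one unit exceed their mean by [e * sq k] with probability at most
    [e ^- 2 / sq k] by Chebyshev; the recent ones have mean one and reach [e * sq k] with
    probability at most [e^-1 / sq k] by Markov. *)
Lemma mild_solution0_squares_le : {ae P, forall w, exists N, forall k, (N <= k)%N ->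
  (Y (sq k) w <= ((1 + 2 * e) * sq k)%:E)%E}.
Proof.
have H1 := @borel_cantelli_bound _ T _ P
  (fun k => [set w | ((sq k - 1 - 0) + e * sq k)%:E <= window_sum 0 (sq k - 1) (sq k) w]%E)
  (fun k => e ^- 2 / sq k) (e ^- 2 * 2).
have H2 := @borel_cantelli_bound _ T _ P
  (fun k => [set w | (e * sq k)%:E <= window_sum (sq k - 1) (sq k) (sq k) w]%E)
  (fun k => e^-1 / sq k) (e^-1 * 2).
have {}H1 := H1 (fun k => mge _ _ _ _).
have {}H2 := H2 (fun k => mge _ _ _ _).
have {}H1 := H1 _ (fun n => sum_sq n _).
have {}H2 := H2 _ (fun n => sum_sq n _).
have := H1 _ _; have := H2 _ _; move=> {}H2 {}H1.
have {}H1 : {ae P, forall w, exists N, forall n, (N <= n)%N ->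
    ~ (((sq n - 1 - 0) + e * sq n)%:E <= window_sum 0 (sq n - 1) (sq n) w)%E}.
  apply: H1; last by rewrite invr_ge0 sqr_ge0.
  move=> k; have k1 := sq_ge1 k.
  have ek : 0 < e * sq k by rewrite mulr_gt0// (lt_le_trans ltr01).
  apply: (@le_trans _ _ (((sq k - 1 - 0) / (e * sq k) ^+ 2)%:E)); last first.
    have k0 : 0 < sq k by exact: lt_le_trans k1.
    have -> : e ^- 2 / sq k = sq k / (e * sq k) ^+ 2 by field; rewrite !gt_eqF.
    by rewrite lee_fin ler_pM2r ?invr_gt0 ?exprn_gt0//; lra.
  have := @window_sum_chebyshev 0 (sq k - 1) (sq k) (e * sq k) (lexx _) _ _ ek.
  rewrite subr_ge0 subrK lexx => /(_ k1 isT); apply: le_trans.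
  apply: le_measure; rewrite ?inE//.
    by apply: measurableU; [exact: mle|exact: mge].
  by move=> w /= H; right.
have {}H2 : {ae P, forall w, exists N, forall n, (N <= n)%N ->
    ~ ((e * sq n)%:E <= window_sum (sq n - 1) (sq n) (sq n) w)%E}.
  apply: H2; last by rewrite invr_ge0 ltW.
  move=> k; have k1 := sq_ge1 k.
  have ek : 0 < e * sq k by rewrite mulr_gt0// (lt_le_trans ltr01).
  have := @window_sum_markov (sq k - 1) (sq k) (sq k) (e * sq k) _ _ (lexx _) ek.
  rewrite subr_ge0 gerBl ler01 => /(_ k1 isT).
  by rewrite opprB addrCA subrr addr0 div1r invfM.
apply: filterS2 H1 H2 => w [N1 h1] [N2 h2]; exists (maxn N1 N2) => k.
rewrite geq_max => /andP[/h1 + /h2].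
move=> /negP; rewrite -ltNge => a1 /negP; rewrite -ltNge => a2.
have k1 := sq_ge1 k.
rewrite (@mild_solution0_split (sq k - 1)) ?subr_ge0//.
apply: (@le_trans _ _ (((sq k - 1 - 0) + e * sq k)%:E + (e * sq k)%:E)%E).
  by rewrite leeD// ltW.
by rewrite -EFinD lee_fin; lra.
Qed.

(** Cutting the window here makes the elapsed times at least [e * sq k], large compared with the gap
    to the next square. *)
Let b k := (1 - e) * sq k.

(** Chebyshev with deviation [e * sq k]. The condition [1 <= e * sq k] puts unit distance between
    the window and the evaluation time; it is made part of the event, which is then empty for small
    [k]. *)
Lemma window_sum_squares_ge : {ae P, forall w, exists N, forall k, (N <= k)%N ->
  1 <= e * sq k -> (((1 - 2 * e) * sq k)%:E <= window_sum 0 (b k) (sq k) w)%E}.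
Proof.
have := @borel_cantelli_bound _ T _ P
  (fun k => [set w | 1 <= e * sq k /\
    (window_sum 0 (b k) (sq k) w <= ((b k - 0) - e * sq k)%:E)%E])
  (fun k => e ^- 2 / sq k) (e ^- 2 * 2).
move=> /(_ _ _ (fun n => sum_sq n _)) H.
have {}H : {ae P, forall w, exists N, forall n, (N <= n)%N -> ~ (1 <= e * sq n /\
    (window_sum 0 (b n) (sq n) w <= ((b n - 0) - e * sq n)%:E)%E)}.
  apply: H; last by rewrite invr_ge0 sqr_ge0.
  - move=> k; have [ek|ek] := leP 1 (e * sq k).
      rewrite (_ : [set w | _] = [set w |
        (window_sum 0 (b k) (sq k) w <= ((b k - 0) - e * sq k)%:E)%E])//.
      by apply/seteqP; split => w /=; [case|].
    by rewrite (_ : [set w | _] = set0)//; apply/seteqP; split => w //= [].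
  - move=> k; have k1 := sq_ge1 k.
    have k0 : 0 < sq k by exact: lt_le_trans k1.
    have ek : 0 < e * sq k by rewrite mulr_gt0.
    have [ek1|ek1] := leP 1 (e * sq k); last first.
      rewrite (_ : [set w | _] = set0) ?measure0 ?lee_fin ?divr_ge0 ?invr_ge0 ?sqr_ge0//.
      by apply/seteqP; split => w //= [].
    apply: (@le_trans _ _ (((b k - 0) / (e * sq k) ^+ 2)%:E)); last first.
      have -> : e ^- 2 / sq k = sq k / (e * sq k) ^+ 2 by field; rewrite !gt_eqF.
      rewrite lee_fin ler_pM2r ?invr_gt0 ?exprn_gt0// /b; nra.
    have := @window_sum_chebyshev 0 (b k) (sq k) (e * sq k) (lexx _) _ _ ek.
    have -> : 0 <= b k by rewrite /b mulr_ge0 ?subr_ge0 ?(ltW e1) ?(ltW k0).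
    have -> : b k + 1 <= sq k by rewrite /b; lra.
    move=> /(_ isT isT); apply: le_trans.
    apply: le_measure; rewrite ?inE//; last first.
    + by move=> w /= [_ H]; left.
    + by apply: measurableU; [exact: mle|exact: mge].
    rewrite (_ : [set w | _] = [set w |
      (window_sum 0 (b k) (sq k) w <= ((b k - 0) - e * sq k)%:E)%E])//.
    by apply/seteqP; split => w /=; [case|].
apply: filterS H => w [N h]; exists N => k /h nk ek.
have /negP : ~ (window_sum 0 (b k) (sq k) w <= ((b k - 0) - e * sq k)%:E)%E.
  by move=> H; apply: nk.
rewrite -ltNge => /ltW; apply: le_trans; rewrite lee_fin /b; lra.
Qed.

(* Between consecutive squares the elapsed times of the points before
   [(1 - e) * k ^ 2] change by a factor that tends to 1. *)
Lemma window_sum_transfer k t w : 3 <= e ^+ 2 * k.+1%:R -> sq k <= t -> t <= sq k.+1 ->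
  (((1 - e) ^+ d)%:E * window_sum 0 (b k) (sq k) w <= Y t w)%E.
Proof.
move=> ek kt tk; rewrite YE /window_sum -psumZ; last first.
  by move=> z; rewrite lee_fin heat_window_ge0.
apply: le_psum => [z|i].
  by rewrite -EFinM lee_fin mulr_ge0 ?heat_window_ge0// exprn_ge0// subr_ge0 ltW.
rewrite -EFinM lee_fin /heat_window indicE.
have [|_] := boolP (_ \in _); last by rewrite mul0r mulr0 heat_kernel_ge0.
rewrite inE/= in_itv/= => /andP[z0 zb]; rewrite mul1r.
move: (tau i w) z0 zb => s s0 sb; move: (eta i w) => y.
have k1 : 1 <= (k.+1%:R : R) by rewrite ler1n.
have us : e * sq k <= sq k - s by move: sb; rewrite /b; lra.
have k0 : 0 < sq k by exact: lt_le_trans (sq_ge1 k).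
have u0 : 0 < sq k - s by apply: lt_le_trans us; rewrite mulr_gt0.
(* Consecutive squares differ by [2 * k + 3]. *)
have tsk : t <= sq k + 3 * k.+1%:R.
  apply: (le_trans tk); rewrite /sq -[k.+2%:R]natr1; nra.
have e2 : 3 * k.+1%:R <= e ^+ 2 * sq k by rewrite /sq; nra.
apply: le_trans (heat_kernel_earlier _ u0 (_ : sq k - s <= t - s)); last lra.
rewrite ler_wpM2r ?heat_kernel_ge0//.
apply: lerXn2r; rewrite ?nnegrE ?divr_ge0 ?subr_ge0 ?(ltW e1)//.
- by rewrite -subr_ge0 ltW.
- lra.
rewrite ler_pdivlMr; last lra.
(* The delay [t - sq k] is thus at most [e] times the elapsed time [sq k - s], so the ratio of
   elapsed times is at least [1 / (1 + e)], hence at least [1 - e]. *)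
have e2u : e ^+ 2 * sq k <= e * (sq k - s) by rewrite expr2 -mulrA ler_pM2l.
have ts : t - s <= (1 + e) * (sq k - s) by lra.
apply: (@le_trans _ _ ((1 - e) * ((1 + e) * (sq k - s)))).
  by rewrite ler_pM2l// subr_gt0.
by rewrite mulrA ler_piMl ?(ltW u0)//; have := sqr_ge0 e; lra.
Qed.

Let le_sq i j : (i <= j)%N -> sq i <= sq j.
Proof. by move=> ij; rewrite /sq ler_sqr ?nnegrE// ler_nat. Qed.

Let between_squares t : 1 <= t -> exists2 k, sq k <= t & t <= sq k.+1.
Proof.
move=> t1; have t0 : 0 <= t by exact: le_trans t1.
have s1 : 1 <= Num.sqrt t by rewrite -[leLHS]sqrtr1 ler_sqrt.
have /andP[] := truncn_itv (sqrtr_ge0 t); set n := Num.truncn _ => ns sn.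
have n0 : (0 < n)%N.
  by rewrite lt0n; apply/eqP => n0; move: sn; rewrite n0 ltNge s1.
have t2 := sqr_sqrtr t0; exists n.-1; rewrite /sq prednK//.
  by rewrite -[leRHS]t2 ler_sqr ?nnegrE ?sqrtr_ge0.
by rewrite -[leLHS]t2 ler_sqr ?nnegrE ?sqrtr_ge0// ltW.
Qed.

(** Combines the factor [(1 - e) ^+ d >= 1 - d * e] of the transfer, the factor [1 - 2 * e] at the
    squares and [t <= (1 + e ^+ 2) * sq k]; the constant [2 * d.+2] covers the three losses. *)
Lemma mild_solution0_eventually_ge : {ae P, forall w, exists M : R, forall t : R, M < t ->
  (((1 - (2 * d.+2%:R) * e) * t)%:E <= Y t w)%E}.
Proof.
apply: filterS window_sum_squares_ge => w [N h].
pose K := maxn N (Num.truncn (3 / e ^+ 2)); exists (sq K) => t Kt.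
have t1 : 1 <= t by apply: le_trans (ltW Kt); exact: sq_ge1.
(* A nonpositive constant is settled by the sign of the solution; a positive one makes [e] small
   enough for the final estimate. *)
have [neg|pos] := leP (1 - (2 * d.+2%:R) * e) 0.
  apply: le_trans (mild_solution0_ge0 t w); rewrite lee_fin mulr_le0_ge0//.
  exact: le_trans t1.
have [k kt tk] := between_squares t1.
have Kk : (K <= k)%N.
  by rewrite leqNgt; apply/negP => /le_sq kK; move: (le_lt_trans (le_trans tk kK) Kt); rewrite ltxx.
have Nk : (N <= k)%N by apply: leq_trans Kk; rewrite leq_maxl.
have ek : 3 <= e ^+ 2 * k.+1%:R.
  rewrite -ler_pdivrMl ?exprn_gt0// mulrC; apply/ltW.
  apply: lt_le_trans (truncnS_gt _) _; rewrite ler_nat ltnS.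
  by apply: leq_trans Kk; rewrite leq_maxr.
have k1 : 1 <= (k.+1%:R : R) by rewrite ler1n.
have esq : 1 <= e * sq k.
  rewrite /sq; move: (k.+1%:R : R) ek k1 => K1 ek k1.
  have : 0 <= e * K1 * (K1 - e).
    by rewrite !mulr_ge0 ?subr_ge0 ?(ltW e0) ?(le_trans ler01 k1) ?(le_trans (ltW e1) k1).
  by move: ek; lra.
have Wk := h _ Nk esq.
apply: le_trans (window_sum_transfer w ek kt tk).
apply: (@le_trans _ _ (((1 - e) ^+ d)%:E * ((1 - 2 * e) * sq k)%:E)%E); last first.
  by rewrite lee_wpmul2l// lee_fin exprn_ge0// subr_ge0 ltW.
rewrite -EFinM lee_fin.
have k0 : 0 < sq k by exact: lt_le_trans (sq_ge1 k).
have tsk : t <= (1 + e ^+ 2) * sq k.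
  apply: (le_trans tk); rewrite /sq -[k.+2%:R]natr1; nra.
have := @bernoulli_le _ e d (ltW e0) (ltW e1).
move: pos; rewrite -[d.+2%:R]natr1 -[d.+1%:R]natr1.
have : 0 <= (d%:R : R) by [].
move: (d%:R : R) ((1 - e) ^+ d) (sq k) k0 tsk => D q s s0 ts D0 pos qD.
have e2 : e ^+ 2 <= e by rewrite expr2 ler_piMl// ltW.
apply: (@le_trans _ _ ((1 - 2 * (D + 1 + 1) * e) * ((1 + e ^+ 2) * s))).
  by rewrite ler_pM2l.
rewrite !mulrA ler_pM2r//.
have De : 0 <= D * e by rewrite mulr_ge0// ltW.
have : 0 <= 1 - 2 * e by move: pos; nra.
move=> e21.
apply: (@le_trans _ _ ((1 - D * e) * (1 - 2 * e))); last by rewrite ler_wpM2r.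
nra.
Qed.

End liminf.

Lemma liminf_mild_solution0 : {ae P, forall w,
  limf_einf (fun t : R => mild_solution0 tau eta t w / t%:E)%E (pinfty_nbhs R) = 1%E}.
Proof.
(* Countably many [e] keep the exceptional set negligible; the shift ensures [e j < 1]. *)
pose e (j : nat) : R := j.+2%:R^-1.
have e0 j : 0 < e j by rewrite invr_gt0.
have e1 j : e j < 1 by rewrite invf_lt1// ltr1n.
have H1 := ae_foralln (fun j => mild_solution0_squares_le (e0 j)).
have H2 := ae_foralln (fun j => mild_solution0_eventually_ge (e0 j) (e1 j)).
have e_small (x : R) : 0 < x -> exists j, e j <= x.
  move=> x0; exists (Num.truncn x^-1); rewrite /e -[leRHS]invrK lef_pV2 ?posrE ?invr_gt0//.
  apply: (@le_trans _ _ (Num.truncn x^-1).+1%:R); first exact/ltW/truncnS_gt.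
  by rewrite ler_nat.
apply: filterS2 H1 H2 => w h1 h2; apply/eqP; rewrite eq_le; apply/andP; split.
- apply/lee_addgt0Pr => x x0.
  have [j jx] := e_small (x / 2) (divr_gt0 x0 (ltr0n R 2)).
  have [N hN] := h1 j; apply: limf_einf_le => M.
  have [k Nk Mk] := sq_unbounded M N; exists (sq k) => //.
  have k0 : 0 < sq k by exact: lt_le_trans (sq_ge1 k).
  rewrite -/(Y _ _) inver gt_eqF// lee_pdivrMr//; apply: (le_trans (hN k Nk)).
  by rewrite -EFinD -EFinM lee_fin ler_pM2r//; lra.
- apply/lee_subgt0Pr => x x0.
  have D0 : 0 < (2 * d.+2%:R : R) by rewrite mulr_gt0.
  have [j jx] := e_small (x / (2 * d.+2%:R)) (divr_gt0 x0 D0).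
  have [M hM] := h2 j; apply: (@limf_einf_ge _ _ _ (Num.max M 0)) => t.
  rewrite gt_max => /andP[Mt t0].
  rewrite -/(Y _ _) inver gt_eqF// lee_pdivlMr//; apply: le_trans (hM t Mt).
  rewrite -EFinB -EFinM lee_fin ler_pM2r// lerD2l lerN2.
  by rewrite -ler_pdivlMl// mulrC.
Qed.

End stochastic_heat_equation.

(** * Infinite limit superior in the divergent case *)

Section limsup_infinite.
Context {R : realType} (d : nat).
Local Notation ST := (measurableTypeR R * d.-tuple R)%type.
Context dT (T : measurableType dT) (P : probability T R).
Variables (tau : nat -> T -> R) (eta : nat -> T -> d.-tuple R).
Hypothesis hnoise : is_standard_poisson_noise P tau eta.
Variable mu : {sigma_finite_measure set ST -> \bar R}.
Hypothesis muE : mu = @lebesgue_space_time R d :> (set _ -> _).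
Hypothesis d_gt0 : (1 <= d)%N.

Let X := noise_point tau eta.
Let mX := measurable_noise_point hnoise.
Let hX := noise_point_count hnoise muE.

Definition space_time_box (k : nat) (r : R) : set ST :=
  `[k%:R, k.+1%:R[%classic `*` [set y | forall i, `]- r, r[%classic (tnth y i)].

Lemma measurable_space_time_box k (r : R) : measurable (space_time_box k r).
Proof.
apply: measurableX; first exact: measurable_itv.
exact: (@measurable_tuple_box R d (fun=> `]- r, r[%classic)).
Qed.

Lemma space_time_box_measure k (r : R) : 0 <= r ->
  mu (space_time_box k r) = ((2 * r) ^+ d)%:E.
Proof.
move=> r0; rewrite (space_time_rect muE); first last.
- move=> t /=; rewrite in_itv/= => /andP[+ _]; exact: le_trans.
- exact: (@measurable_tuple_box R d (fun=> `]- r, r[%classic)).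
- exact: measurable_itv.
rewrite lebesgue_measure_itv/= lte_fin ltr_nat ltnSn -EFinD.
rewrite -[k.+1%:R]natr1 addrAC subrr add0r mul1e.
have /= -> := @lebesgue_tuple_prod R d (fun=> `]- r, r[%classic) (fun=> measurable_itv _).
rewrite (eq_bigr (fun=> (2 * r)%:E)); last first.
  move=> i _; rewrite lebesgue_measure_itv/= lte_fin.
  move: r0; rewrite le_eqVlt => /orP[/eqP <-|r0]; first by rewrite oppr0 ltxx mulr0.
  by rewrite gtrN// -EFinD; congr EFin; ring.
by rewrite prodEFin prodr_const card_ord.
Qed.

Lemma space_time_box_enorm k (r : R) z : 0 <= r -> space_time_box k r z ->
  enorm z.2 ^+ 2 <= d%:R * r ^+ 2.
Proof.
move=> r0 [_ /= zr]; rewrite enorm_sqr.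
apply: (@le_trans _ _ (\sum_(i < d) r ^+ 2)).
  apply: ler_sum => i _; have := zr i; rewrite in_itv/= => /andP[ri ir].
  rewrite -[leLHS]real_normK ?num_real// ler_sqr ?nnegrE//.
  by rewrite ler_norml ltW// ltW.
by rewrite sumr_const card_ord mulr_natl.
Qed.

Let tbox (r : nat -> R) : trivIset setT (fun k => space_time_box k (r k)).
Proof.
apply/trivIsetP => i j _ _ ij; apply/seteqP; split => // z [[zi _] [zj _]].
move: zi zj; rewrite /= !in_itv/= => /andP[it ti] /andP[jt tj].
have : (i%:R < j.+1%:R :> R) by exact: le_lt_trans tj.
have : (j%:R < i.+1%:R :> R) by exact: le_lt_trans ti.
by rewrite !ltr_nat !ltnS => ji ij'; move: ij; rewrite neq_ltn => /orP[]; lia.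
Qed.

(** The event that all boxes from the [m]-th on are empty lies in the void event of every finite
    union of them, whose probability is [expR] of minus the volume; these volumes are unbounded. *)
Lemma infinitely_many_boxes_hit (r : nat -> R) : (forall k, 0 <= r k) ->
  (forall M : R, exists n, M <= \sum_(k < n) (2 * r k) ^+ d) ->
  {ae P, forall w, forall m, exists2 k, (m <= k)%N &
    exists i, space_time_box k (r k) (X i w)}.
Proof.
move=> r0 rM; pose B k := space_time_box k (r k).
have mB k : measurable (B k) by exact: measurable_space_time_box.
apply/ae_foralln => m.
pose V := \bigcap_k \bigcap_i (X i @^-1` (~` B (m + k)%N)).
have mV : measurable V.
  apply: bigcapT_measurable => k; apply: bigcapT_measurable => i.
  rewrite -[X in measurable X]setTI; apply: mX => //; exact: measurableC.
exists V; split => //; last first.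
  move=> w /= nw k _ i _ /= Bw; apply: nw; exists (m + k)%N; first exact: leq_addr.
  by exists i.
pose U n := \big[setU/set0]_(k < n) B (m + k)%N.
have mU n : measurable (U n) by apply: bigsetU_measurable => k _.
have muU n : mu (U n) = (\sum_(k < n) (2 * r (m + k)%N) ^+ d)%:E.
  rewrite -sumEFin /U measure_semi_additive_ord//; last 2 first.
  - apply/trivIsetP => i j _ _ ij.
    by have /trivIsetP := @tbox r; apply => //; rewrite eqn_add2l.
  - exact: mU.
  by apply: eq_bigr => k _; exact: space_time_box_measure.
have PV n : (P V <= (expR (- \sum_(k < n) (2 * r (m + k)%N) ^+ d))%:E)%E.
  have Uoo : (mu (U n) < +oo)%E by rewrite muU ltry.
  have := void_probability hX (mU n) Uoo; rewrite muU/= => <-.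
  apply: le_measure; rewrite ?inE//.
    have mN : measurable_fun setT (psum X (fun x => (\1_(U n) x)%:E : \bar R)).
      apply: measurable_psum => //.
      by apply/measurable_EFinP; exact: measurable_indic.
    by have := mN measurableT _ (emeasurable_set1 0%E); rewrite setTI.
  move=> w Vw /=; apply: eseries0 => i _ _; congr EFin.
  rewrite indicE memNset//= => Ui.
  have [k _ kB] : (\bigcup_(k in `I_n) B (m + k)%N) (X i w) by rewrite bigcup_mkord.
  exact: (Vw k I i I).
apply/eqP; rewrite eq_le measure_ge0 andbT; apply/lee_addgt0Pr => x x0; rewrite add0e.
(* After the first [m] boxes are discounted the volume is still at least [x^-1], and [expR v >= v]
   makes the void probability at most [x]. *)
have [n hn] := rM (x^-1 + \sum_(k < m) (2 * r k) ^+ d).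
have {}hn : x^-1 <= \sum_(k < n) (2 * r (m + k)%N) ^+ d.
  have : \sum_(k < n) (2 * r k) ^+ d <= \sum_(k < m + n) (2 * r k) ^+ d.
    rewrite addnC big_split_ord/= lerDl sumr_ge0// => k _.
    by rewrite exprn_ge0// mulr_ge0.
  by rewrite big_split_ord/=; lra.
apply: (le_trans (PV n)); rewrite lee_fin expRN.
rewrite -[leRHS]invrK lef_pV2 ?posrE ?expR_gt0 ?invr_gt0//.
by apply: (le_trans hn); apply: le_trans (expR_ge1Dx _); lra.
Qed.

Variable f : R -> R.
Hypothesis f_gt0 : forall t : R, 0 < t -> 0 < f t.
Hypothesis f_ndecr : forall s t : R, 0 < s -> s <= t -> f s <= f t.

(** Gives the half-side of a box; [r <= 1] ensures that a point arriving before [k + 1] is observed,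
    [r ^+ 2] later, before [k + 2]. *)
Let root (x : R) : 0 < x -> x <= 1 -> {r : R | 0 < r & r <= 1 /\ r ^+ d = x}.
Proof.
move=> x0 x1; exists (x `^ (d%:R^-1)); first exact: powR_gt0.
have xE : x `^ (d%:R^-1) ^+ d = x.
  by rewrite -powR_mulrn ?powR_ge0// -powRrM mulVf ?powRr1 ?ltW// pnatr_eq0 -lt0n.
by split => //; rewrite -(@expr_le1 _ d) ?powR_ge0// xE.
Qed.

Let c0 : R := heat_peak 1 ^+ d * expR (- d%:R).

Let c0_gt0 : 0 < c0.
Proof. by rewrite mulr_gt0 ?expR_gt0// exprn_gt0// heat_peak_gt0. Qed.

Hypothesis f_inf :
  (\int[@lebesgue_measure R]_(t in `[1%R, +oo[) ((f t)^-1)%:E = +oo)%E.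

(** With [r k ^+ d = a / f (k + 2)], a point in the [k]-th box contributes at least
    [c0 / r k ^+ d = c0 / a * f (k + 2)] at a time [r k ^+ 2] after its arrival, where [f] is at
    most [f (k + 2)]. *)
Lemma mild_solution0_infinitely_often (a : R) : 0 < a -> a <= f 1 ->
  {ae P, forall w, forall M : R, exists2 t, M < t &
    (((c0 / a) * f t)%:E <= mild_solution0 tau eta t w)%E}.
Proof.
move=> a0 af1.
have fk (k : nat) : f 1 <= f k.+2%:R by apply: f_ndecr => //; rewrite ler1n.
have fk0 (k : nat) : 0 < f k.+2%:R by exact: f_gt0.
have af0 k : 0 < a / f k.+2%:R by rewrite divr_gt0.
have af_le1 k : a / f k.+2%:R <= 1.
  by rewrite ler_pdivrMr// mul1r (le_trans af1).
pose r k := s2val (root (af0 k) (af_le1 k)).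
have r0 k : 0 < r k by exact: (s2valP (root _ _)).
have r1 k : r k <= 1 by have [] := s2valP' (root (af0 k) (af_le1 k)).
have rE k : r k ^+ d = a / f k.+2%:R by have [] := s2valP' (root (af0 k) (af_le1 k)).
have rM (M : R) : exists n, M <= \sum_(k < n) (2 * r k) ^+ d.
  have C0 : 0 < 2 ^+ d * a by rewrite mulr_gt0// exprn_gt0.
  (* The extra [(f 1)^-1] pays for the first term, lost when the index [k.+1] is shifted to
     [k.+2]. *)
  have [n hn] := sum_inv_unbounded f_gt0 f_ndecr f_inf
    (M / (2 ^+ d * a) + (f 1)^-1).
  exists n; rewrite (eq_bigr (fun k : 'I_n => (2 ^+ d * a) * (f k.+2%:R)^-1)); last first.
    by move=> k _; rewrite exprMn rE mulrA.
  rewrite -mulr_sumr -ler_pdivrMl// mulrC.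
  have : \sum_(k < n) (f k.+1%:R)^-1 <= \sum_(k < n.+1) (f k.+1%:R)^-1.
    by rewrite big_ord_recr/= lerDl invr_ge0 ltW// f_gt0.
  by rewrite big_ord_recl/=; move: hn; lra.
apply: filterS (infinitely_many_boxes_hit (fun k => ltW (r0 k)) rM) => w hw M.
have [k kM [i Bi]] := hw (Num.truncn M).+1.
have [/= + _] := Bi; rewrite in_itv/= => /andP[kt tk].
exists (tau i w + r k ^+ 2).
  apply: (lt_le_trans (truncnS_gt M)); apply: (@le_trans _ _ (k%:R)).
    by rewrite ler_nat.
  by apply: (le_trans kt); rewrite lerDl sqr_ge0.
set t := _ + _.
have t0 : 0 < t by rewrite ltr_wpDl ?exprn_gt0//; exact: noise_time_ge0 hnoise i w.
have ft : f t <= f k.+2%:R.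
  apply: f_ndecr => //; rewrite /t -[k.+2%:R]natr1 lerD ?(ltW tk)//.
  by rewrite expr_le1// ltW.
rewrite mild_solution0E /psum (@nneseriesD1 _ _ i)//; last first.
  by move=> j _; rewrite lee_fin heat_kernel_ge0.
apply: lee_paddr.
  by apply: nneseries_ge0 => j _ _; rewrite lee_fin heat_kernel_ge0.
rewrite lee_fin /= /t addrAC subrr add0r.
apply: le_trans (heat_kernel_near (r0 k) (space_time_box_enorm (ltW (r0 k)) Bi)).
rewrite -/c0 rE invfM invrK mulrA -[c0 / a * f t]mulrA.
by rewrite -[leRHS]mulrA ler_pM2l// ler_pM2l// invr_gt0.
Qed.

Lemma limsup_mild_solution0_infinite : {ae P, forall w,
  limf_esup (fun t : R => mild_solution0 tau eta t w / (f t)%:E)%E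
    (pinfty_nbhs R) = +oo%E}.
Proof.
have f1 := f_gt0 ltr01.
(* Values of [a] tending to zero, so that [c0 / a j] exceeds any bound. *)
pose a (j : nat) := f 1 / j.+1%:R.
have a0 j : 0 < a j by rewrite divr_gt0.
have af j : a j <= f 1 by rewrite ler_pdivrMr// ler_peMr ?ler1n// ltW.
have H := ae_foralln (fun j => mild_solution0_infinitely_often (a0 j) (af j)).
apply: filterS H => w hw; apply: eq_infty => x.
pose j := Num.truncn (x * f 1 / c0).
have jx : x <= c0 / a j.
  rewrite /a invfM invrK mulrA -ler_pdivrMl ?divr_gt0// mulrC.
  have -> : x / (c0 / f 1) = x * f 1 / c0 by rewrite invfM invrK mulrA mulrAC.
  exact/ltW/truncnS_gt.
apply: limf_esup_ge => M; have [t] := hw j (Num.max M 0).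
rewrite gt_max => /andP[Mt t0] Yt; exists t => //.
have ft := f_gt0 t0.
rewrite inver gt_eqF// lee_pdivlMr//; apply: le_trans Yt.
by rewrite -EFinM lee_fin ler_pM2r.
Qed.

End limsup_infinite.

(** * Zero limit superior in the convergent case *)

Section limsup_zero.
Context {R : realType} (d : nat).
Local Notation ST := (measurableTypeR R * d.-tuple R)%type.
Context dT (T : measurableType dT) (P : probability T R).
Variables (tau : nat -> T -> R) (eta : nat -> T -> d.-tuple R).
Hypothesis hnoise : is_standard_poisson_noise P tau eta.
Variable mu : {sigma_finite_measure set ST -> \bar R}.
Hypothesis muE : mu = @lebesgue_space_time R d :> (set _ -> _).
Hypothesis d_gt0 : (1 <= d)%N.

Let X := noise_point tau eta.
Let mX := measurable_noise_point hnoise.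
Let hX := noise_point_count hnoise muE.

(** Quartering the time doubles the peak in each dimension; the first scale, 4, exceeds all elapsed
    times of recent points. *)
Let s_ (k : nat) : R := 4 / 4 ^+ k.

Let s_gt0 k : 0 < s_ k.
Proof. by rewrite divr_gt0// exprn_gt0. Qed.

Let s_S k : s_ k = 4 * s_ k.+1.
Proof.
rewrite /s_ exprS; have : (4 ^+ k : R) != 0 by rewrite gt_eqF ?exprn_gt0.
by move: (4 ^+ k : R) => q q0; field; rewrite q0.
Qed.

(** The alternatives are those of [heat_kernel_far] and [heat_kernel_later]. *)
Let s_cover K s : s <= 4 -> s <= s_ K \/ exists2 k, (k < K)%N & s <= s_ k <= 4 * s.
Proof.
move=> s4; elim: K => [|K ih]; first by left; rewrite /s_ expr0 divr1.
have [sK|Ks] := leP s (s_ K.+1); [by left|right].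
case: ih => [sK|[k kK ks]]; last by exists k => //; exact: ltnW.
by exists K => //; rewrite sK/= s_S ler_pM2l// ltW.
Qed.

(** The elapsed time is frozen at [s_ k], so one event controls all evaluation times in a unit
    interval. *)
Definition dyadic_kernel (a b : R) (k : nat) (z : ST) : R :=
  \1_(`[a, b[%classic : set R) z.1 * heat_kernel (s_ k) z.2.

Lemma dyadic_kernel_ge0 a b k z : 0 <= dyadic_kernel a b k z.
Proof. by rewrite mulr_ge0// heat_kernel_ge0. Qed.

Lemma measurable_dyadic_kernel a b k : measurable_fun setT (dyadic_kernel a b k).
Proof.
apply: measurable_funM; first exact: measurable_indic_time.
by apply: (measurableT_comp (@measurable_heat_kernel _ d (s_ k))).
Qed.

Definition dyadic_sum (a b : R) (K : nat) (z : ST) : R :=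
  \sum_(k < K.+1) dyadic_kernel a b k z.

Lemma dyadic_sum_ge0 a b K z : 0 <= dyadic_sum a b K z.
Proof. by apply: sumr_ge0 => k _; exact: dyadic_kernel_ge0. Qed.

Lemma measurable_dyadic_sum a b K : measurable_fun setT (dyadic_sum a b K).
Proof. by apply: measurable_sum => k; exact: measurable_dyadic_kernel. Qed.

Section fixed_interval.
Variables a b : R.
Hypotheses (a0 : 0 <= a) (ab : b = a + 2).

Let ab_le : a <= b. Proof. by rewrite ab lerDl. Qed.

Let ba : b - a = 2. Proof. by rewrite ab addrAC subrr add0r. Qed.

Lemma integral_dyadic_kernel k : (\int[mu]_z (dyadic_kernel a b k z)%:E = 2%:E)%E.
Proof.
by rewrite /dyadic_kernel (integral_heat_product muE a0 ab_le (s_gt0 k)) ba.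
Qed.

(** At time [s_ k] the kernel is at most [(2 ^+ k) ^+ d], and its integral over the window is 2. *)
Lemma integral_dyadic_kernel_sqr k :
  (\int[mu]_z (dyadic_kernel a b k z ^+ 2)%:E <= (2 * (2 ^+ k) ^+ d)%:E)%E.
Proof.
rewrite mulrC EFinM -(integral_dyadic_kernel k) -ge0_integralZl//; first last.
- by move=> z _; rewrite lee_fin dyadic_kernel_ge0.
- by apply/measurable_EFinP; exact: measurable_dyadic_kernel.
have mk := measurable_dyadic_kernel a b k.
apply: ge0_le_integral => //.
- by move=> z _; rewrite lee_fin sqr_ge0.
- by apply/measurable_EFinP; exact: measurable_funX.
- by apply/measurable_EFinP; exact: measurable_funM.
move=> z _; rewrite -EFinM lee_fin expr2 ler_wpM2r ?dyadic_kernel_ge0//.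
apply: (@le_trans _ _ (1 * heat_kernel (s_ k) z.2)).
  by rewrite ler_wpM2r ?heat_kernel_ge0// indicE lern1 leq_b1.
rewrite mul1r; apply: heat_kernel_ub => //.
rewrite /s_ -exprM mulnC exprM (_ : 2 ^+ 2 = 4); last by rewrite expr2; lra.
by rewrite divfK ?gt_eqF ?exprn_gt0// ler1n.
Qed.

Lemma integral_dyadic_sum K :
  (\int[mu]_z (dyadic_sum a b K z)%:E = (2 * K.+1%:R)%:E)%E.
Proof.
under eq_integral do rewrite /dyadic_sum -sumEFin.
rewrite ge0_integral_sum//; first last.
- by move=> k z _; rewrite lee_fin dyadic_kernel_ge0.
- by move=> k; apply/measurable_EFinP; exact: measurable_dyadic_kernel.
under eq_bigr do rewrite integral_dyadic_kernel.
by rewrite sumEFin sumr_const card_ord mulr_natr.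
Qed.

Let twod : 2 <= 2 ^+ d :> R.
Proof. by rewrite -[leLHS]expr1 ler_weXn2l// ler1n. Qed.

(* [(x + y)^2 <= 6/5 x^2 + 6 y^2], and [2^d] exceeds the factor [6/5], so the
   last summand dominates. *)
Lemma integral_dyadic_sum_sqr K :
  (\int[mu]_z (dyadic_sum a b K z ^+ 2)%:E <= (90 * (2 ^+ d) ^+ K)%:E)%E.
Proof.
elim: K => [|K ih].
  rewrite /dyadic_sum; under eq_integral do rewrite big_ord1.
  apply: (le_trans (integral_dyadic_kernel_sqr 0)).
  by rewrite lee_fin !expr0 expr1n; lra.
have mS := measurable_dyadic_sum a b K.
have mk := measurable_dyadic_kernel a b K.+1.
have mS2 : measurable_fun setT (fun z => (dyadic_sum a b K z ^+ 2)%:E).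
  by apply/measurable_EFinP; exact: measurable_funX.
have mk2 : measurable_fun setT (fun z => (dyadic_kernel a b K.+1 z ^+ 2)%:E).
  by apply/measurable_EFinP; exact: measurable_funX.
apply: (@le_trans _ _ (\int[mu]_z ((6 / 5)%:E * (dyadic_sum a b K z ^+ 2)%:E +
    6%:E * (dyadic_kernel a b K.+1 z ^+ 2)%:E))%E).
  apply: ge0_le_integral => //.
  - by move=> z _; rewrite lee_fin sqr_ge0.
  - apply/measurable_EFinP; apply: measurable_funX; exact: measurable_dyadic_sum.
  - by apply: emeasurable_funD; apply: emeasurable_funM.
  move=> z _; rewrite -!EFinM -EFinD lee_fin.
  rewrite /dyadic_sum big_ord_recr/= -/(dyadic_sum a b K z).
  move: (dyadic_sum _ _ _ _) (dyadic_kernel _ _ _ _) => x y.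
  (* The two sides differ by [(x - 5 * y) ^+ 2 / 5]. *)
  have := sqr_ge0 (x - 5 * y); lra.
rewrite ge0_integralD//; first last.
- by apply: emeasurable_funM.
- by move=> z _; apply: mule_ge0; rewrite lee_fin ?sqr_ge0.
- by apply: emeasurable_funM.
- by move=> z _; apply: mule_ge0; rewrite lee_fin ?sqr_ge0// divr_ge0.
rewrite !ge0_integralZl//; try by move=> z _; rewrite lee_fin sqr_ge0.
apply: (@le_trans _ _ ((6 / 5)%:E * (90 * (2 ^+ d) ^+ K)%:E +
    6%:E * (2 * (2 ^+ K.+1) ^+ d)%:E)%E).
  apply: leeD; apply: lee_wpmul2l => //; try by rewrite lee_fin divr_ge0.
  exact: integral_dyadic_kernel_sqr.
rewrite -!EFinM -EFinD lee_fin.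
have -> : (2 ^+ K.+1) ^+ d = 2 ^+ d * (2 ^+ d) ^+ K :> R.
  by rewrite -exprM mulnC exprM exprS.
rewrite [(2 ^+ d) ^+ K.+1]exprS.
have q0 : 0 < (2 ^+ d) ^+ K :> R by rewrite !exprn_gt0.
(* What remains is [108 + 12 * D <= 90 * D], true for [D >= 2]. *)
move: (2 ^+ d : R) q0 twod => D; move: (D ^+ K) => q q0 D2.
nra.
Qed.

(** The squared mean is only quadratic in [K], so the exponential bound on the variance absorbs
    it. *)
Let sqr_log_le K : (2 * K.+1%:R) ^+ 2 <= 90 * (2 ^+ d) ^+ K :> R.
Proof.
elim: K => [|K ih]; first by rewrite expr0 expr2; lra.
rewrite [(2 ^+ d) ^+ K.+1]exprS -[K.+2%:R]natr1; move: ih.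
have q1 : 1 <= (2 ^+ d) ^+ K :> R by rewrite exprn_ege1// exprn_ege1// ler1n.
move: (2 ^+ d : R) q1 twod (K.+1%:R : R) => D; move: (D ^+ K) => q q1 D2 m ih.
(* Bounds the linear term: [8 * m <= 4 / 5 * m ^+ 2 + 20]. *)
have := sqr_ge0 (2 * m - 10); nra.
Qed.

(** The squared mean and the variance are each at most [90 * c]; dividing by [c ^+ 2] leaves
    [180 / c]. *)
Lemma dyadic_sum_large K (c : R) : 0 < c -> (2 ^+ d) ^+ K <= c ->
  (P [set w | c%:E <= psum X (EFin \o dyadic_sum a b K) w] <= (180 / c)%:E)%E.
Proof.
move=> c0 Kc.
have := @psum_markov2 _ _ _ _ _ _ mu _ mX hX _ (measurable_dyadic_sum a b K)
  (dyadic_sum_ge0 a b K) _ _ c c0 _ _ (integral_dyadic_sum_sqr K).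
move=> /(_ (2 * K.+1%:R)); rewrite mulr_ge0// integral_dyadic_sum lexx.
move=> /(_ isT isT) H; apply: (le_trans H); rewrite lee_fin.
rewrite [c ^+ 2]expr2 invfM mulrA ler_pM2r ?invr_gt0// ler_pdivrMr//.
have := sqr_log_le K; lra.
Qed.

Lemma dyadic_kernel_large K (c : R) : 0 < c ->
  (P [set w | c%:E <= psum X (EFin \o dyadic_kernel a b K) w] <= (2 / c)%:E)%E.
Proof.
move=> c0; apply: (psum_markov mX hX) => //.
- exact: measurable_dyadic_kernel.
- exact: dyadic_kernel_ge0.
- by rewrite integral_dyadic_kernel.
Qed.

Lemma heat_peak_dyadic K : heat_peak (s_ K) = 2 ^+ K * heat_peak 4.
Proof.
rewrite /heat_peak; have -> : 4 * pi * s_ K = 4 * pi * 4 * (2 ^- K) ^+ 2.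
  rewrite /s_ mulrA; congr (_ * _); rewrite exprVn -exprM mulnC exprM.
  by rewrite (_ : 2 ^+ 2 = 4 :> R)//; rewrite expr2; lra.
rewrite sqrtrM ?mulr_ge0 ?pi_ge0// sqrtr_sqr ger0_norm ?invr_ge0 ?exprn_ge0//.
by rewrite invfM invrK mulrC.
Qed.

Let point_le (h : ST -> R) i w : (forall z : ST, 0 <= h z) ->
  ((h (X i w))%:E <= psum X (EFin \o h) w)%E.
Proof.
move=> h0; rewrite /psum (@nneseriesD1 _ _ i)//; last by move=> j _; rewrite lee_fin.
by rewrite leeDl//; apply: nneseries_ge0 => j _ _; rewrite lee_fin.
Qed.

(** A single point closer to the origin would have exponent at most [d] at scale [s_ K] and reach
    the threshold by itself. *)
Lemma points_are_far K w : (psum X (EFin \o dyadic_kernel a b K) w <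
    ((2 ^+ d) ^+ K * (heat_peak 4 ^+ d * expR (- d%:R)))%:E)%E ->
  forall i, a <= tau i w -> tau i w < b ->
  4 * d%:R * s_ K <= enorm (eta i w) ^+ 2.
Proof.
move=> small i ai ib; rewrite leNgt; apply/negP => near.
move: small; rewrite ltNge => /negP; apply.
apply: le_trans (point_le i w (dyadic_kernel_ge0 a b K)).
rewrite lee_fin /dyadic_kernel/= indicE mem_set; last by rewrite /= in_itv/= ai.
rewrite mul1r heat_kernelE// heat_peak_dyadic exprMn -exprM mulnC exprM -mulrA.
rewrite ler_pM2l ?exprn_gt0// ler_pM2l ?exprn_gt0 ?heat_peak_gt0//.
rewrite ler_expR lerN2 ler_pdivrMr ?mulr_gt0//.
by rewrite mulrA [_ * 4]mulrC ltW.
Qed.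

(* At scales below [s_ K] the kernel is increasing in time at the points that
   are far from the origin; above, it is compared with the next scale. *)
Lemma recent_sum_le K t w : t <= b ->
  (forall i, a <= tau i w -> tau i w < b ->
    4 * d%:R * s_ K <= enorm (eta i w) ^+ 2) ->
  (window_sum tau eta a t t w <= (2 ^+ d)%:E * psum X (EFin \o dyadic_sum a b K) w)%E.
Proof.
move=> tb far; rewrite /window_sum -psumZ; last first.
  by move=> z; rewrite lee_fin dyadic_sum_ge0.
apply: le_psum => [z|i]; first by rewrite lee_fin heat_window_ge0.
rewrite -EFinM lee_fin /heat_window indicE.
have [|_] := boolP (_ \in _); last first.
  by rewrite mul0r mulr_ge0 ?exprn_ge0// dyadic_sum_ge0.
rewrite inE/= in_itv/= => /andP[ai it]; rewrite mul1r.
have ib : tau i w < b by exact: lt_le_trans tb.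
have s0 : 0 < t - tau i w by rewrite subr_gt0.
have s4 : t - tau i w <= 4 by move: tb ai; rewrite ab; lra.
have term k : (k <= K)%N ->
    heat_kernel (s_ k) (eta i w) <= dyadic_sum a b K (X i w).
  move=> kK; rewrite /dyadic_sum (bigD1 (Ordinal (kK : (k < K.+1)%N)))//=.
  rewrite -[leLHS]addr0; apply: lerD.
    rewrite /dyadic_kernel/= indicE mem_set ?mul1r//.
    by rewrite /= in_itv/= ai.
  by apply: sumr_ge0 => j _; exact: dyadic_kernel_ge0.
have [sK|[k kK /andP[sk ks]]] := s_cover K s4.
  apply: le_trans (heat_kernel_far s0 sK (far i ai ib)) _.
  apply: (le_trans (term K (leqnn K))).
  by rewrite ler_peMl ?dyadic_sum_ge0// exprn_ege1// ler1n.
apply: (le_trans (heat_kernel_later _ s0 sk ks)).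
by rewrite ler_pM2l ?exprn_gt0//; apply: term; exact: ltnW.
Qed.

End fixed_interval.

(** These points have elapsed time more than one at [t], and waiting until [n + 1] adds at most one,
    within the factor 4 of [heat_kernel_later]. A single time thus controls the whole interval. *)
Lemma old_sum_le (n : nat) t w : (2 <= n)%N -> n%:R <= t -> t <= n%:R + 1 ->
  (window_sum tau eta 0 (n%:R - 1) t w <=
   (2 ^+ d)%:E * window_sum tau eta 0 (n%:R - 1) (n%:R + 1) w)%E.
Proof.
move=> n2 nt tn; rewrite /window_sum -psumZ; last first.
  by move=> z; rewrite lee_fin heat_window_ge0.
apply: le_psum => [z|i]; first by rewrite lee_fin heat_window_ge0.
rewrite -EFinM lee_fin /heat_window indicE.
have [|_] := boolP (_ \in _); last by rewrite !mul0r mulr0.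
rewrite inE/= in_itv/= => /andP[i0 iN]; rewrite !mul1r.
by apply: heat_kernel_later; lra.
Qed.

Section eventual_bound.
Variable f : R -> R.
Hypothesis f_gt0 : forall t : R, 0 < t -> 0 < f t.
Hypothesis f_ndecr : forall s t : R, 0 < s -> s <= t -> f s <= f t.
Variable M : R.
Hypothesis fM : forall n, \sum_(k < n) (f k.+2%:R)^-1 <= M.

(* Otherwise the reciprocals of the values of [f] near [n] would contribute
   too much to the convergent series. *)
Lemma eventually_nat_le : exists2 N, (2 <= N)%N & forall n, (N <= n)%N -> n%:R <= f n%:R.
Proof.
pose S := [set x | exists n, x = \sum_(k < n) (f k.+2%:R)^-1].
have hS : has_sup S.
  split; first by exists (\sum_(k < 0) (f k.+2%:R)^-1); exists 0%N.
  by exists M => _ [n ->].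
have q4 : 0 < 4^-1 :> R by rewrite invr_gt0.
have [_ [N ->] hN] := sup_adherent q4 hS.
exists (2 * N + 4)%N; first by lia.
(* The [m] terms after the first [N] have arguments at most [n], so each is at least [1 / f n];
   together they are at most 1/4, and [n <= 2 * m]. *)
move=> n nN; have [m nE] : exists m, n = (N + m).+1 /\ (N + 3 <= m)%N.
  by exists (n - N.+1)%N; lia.
case: nE => nE mN.
have n0 : 0 < (n%:R : R) by rewrite ltr0n nE.
have fn0 : 0 < f n%:R by exact: f_gt0.
have : \sum_(k < N + m) (f k.+2%:R)^-1 <= sup S.
  by apply: ub_le_sup; [case: hS|exists (N + m)%N].
rewrite big_split_ord/= => H.
have : m%:R * (f n%:R)^-1 <= \sum_(k < m) (f (N + k).+2%:R)^-1.
  rewrite mulr_natl -[m in leLHS]card_ord -sumr_const; apply: ler_sum => k _.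
  rewrite lef_pV2 ?posrE ?f_gt0//; apply: f_ndecr => //.
  by rewrite ler_nat nE !ltnS; have := ltn_ord k; lia.
move=> H2; have {H2} : m%:R * (f n%:R)^-1 <= 4^-1 by move: H H2 hN; lra.
rewrite ler_pdivrMr// => mf.
have : (n%:R : R) <= 2 * m%:R by rewrite -natrM ler_nat nE; lia.
move: mf; lra.
Qed.

Let log_exists (x : R) : 1 <= x ->
  exists K, (2 ^+ d) ^+ K <= x /\ x < (2 ^+ d) ^+ K.+1.
Proof.
move=> x1; have D2 : 2 <= 2 ^+ d :> R by rewrite -[leLHS]expr1 ler_weXn2l// ler1n.
have big n : n%:R <= (2 ^+ d) ^+ n :> R.
  apply: (@le_trans _ _ (2 ^+ n)); first by rewrite -natrX ler_nat ltnW// ltn_expl.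
  by apply: lerXn2r => //; rewrite nnegrE ?exprn_ge0.
have ex : exists n, x < (2 ^+ d) ^+ n.
  by exists (Num.truncn x).+1; apply: lt_le_trans (truncnS_gt x) (big _).
case: (ex_minnP ex) => -[|K] xK Kmin.
  by move: xK; rewrite expr0 ltNge x1.
exists K; split => //; rewrite leNgt; apply/negP => /Kmin; by rewrite ltnn.
Qed.

(** Each integer [n] has three bad events of probability at most a constant over [f n]: an excess of
    old points, a recent point too near, a large dyadic sum. Off them the old points give at most
    [2 ^+ d * (2 * f n)] and the recent ones [2 ^+ d * f n]. *)
Lemma mild_solution0_eventually_le : {ae P, forall w, exists N : R, forall t : R, N < t ->
  (mild_solution0 tau eta t w <= (3 * 2 ^+ d * f t)%:E)%E}.
Proof.
have [N N2 fN] := eventually_nat_le.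
pose n k : R := (N + k)%:R.
have n2 k : 2 <= n k by rewrite /n ler_nat (leq_trans N2)// leq_addr.
have nf k : n k <= f (n k) by apply: fN; exact: leq_addr.
have f2 k : 2 <= f (n k) by apply: le_trans (nf k).
have f0 k : 0 < f (n k) by apply: lt_le_trans (f2 k).
(* The power is comparable with [f (n k)]: its upper bound serves the dyadic sum, its lower bound
   makes a near point improbable. *)
have /choice[K hK] : forall k, exists K, (2 ^+ d) ^+ K <= f (n k) /\ f (n k) < (2 ^+ d) ^+ K.+1.
  by move=> k; apply: log_exists; apply: le_trans (f2 k); rewrite ler1n.
have sumf m : \sum_(k < m) (f (n k))^-1 <= M.
  have [N' NE] : exists N', N = N'.+2 by exists N.-2; move: N2; lia.
  apply: le_trans (fM (N' + m)); rewrite big_split_ord/= -[leLHS]add0r lerD//.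
    by apply: sumr_ge0 => k _; rewrite invr_ge0 ltW// f_gt0.
  by apply: ler_sum => k _; rewrite /n NE.
have sumCf (C : R) m : 0 <= C -> \sum_(k < m) C / f (n k) <= C * M.
  by move=> C0; rewrite -mulr_sumr ler_wpM2l.
pose c0 : R := heat_peak 4 ^+ d * expR (- d%:R).
have c00 : 0 < c0 by rewrite mulr_gt0 ?expR_gt0// exprn_gt0// heat_peak_gt0.
have D0 : 0 < 2 ^+ d :> R by rewrite exprn_gt0.
have mge (h : ST -> R) c : measurable_fun setT h -> (forall z, 0 <= h z) ->
    measurable [set w | (c <= psum X (EFin \o h) w)%E].
  by move=> mh h0; exact: measurable_psum_ge.
(* The variance is at most [n k - 1], hence at most [f (n k)], against a squared deviation
   [f (n k) ^+ 2]. *)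
have H1 : {ae P, forall w, exists N, forall k, (N <= k)%N ->
    ~ ((n k - 1 - 0 + f (n k))%:E <= window_sum tau eta 0 (n k - 1) (n k + 1) w)%E}.
  apply: (@borel_cantelli_bound _ _ _ _ _ (fun k => 1 / f (n k)) (1 * M)).
  - move=> k; apply: mge; first exact: measurable_heat_window.
    exact: heat_window_ge0.
  - move=> k; have nk := n2 k.
    have := @window_sum_chebyshev _ _ _ _ _ _ _ hnoise _ muE 0 (n k - 1) (n k + 1)
      (f (n k)) (lexx _) _ _ (f0 k).
    have -> : 0 <= n k - 1 by lra.
    have -> : n k - 1 + 1 <= n k + 1 by lra.
    move=> /(_ isT isT) H; apply: (@le_trans _ _ (((n k - 1 - 0) / f (n k) ^+ 2)%:E)).
      apply: le_trans H; apply: le_measure; rewrite ?inE.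
      + apply: mge; [exact: measurable_heat_window|exact: heat_window_ge0].
      + apply: measurableU.
          apply: measurable_psum_le; first exact: mX.
            exact: measurable_heat_window.
          exact: heat_window_ge0.
        by apply: mge; [exact: measurable_heat_window|exact: heat_window_ge0].
      + by move=> w /= ?; right.
    rewrite lee_fin [f _ ^+ 2]expr2 invfM mulrA ler_pM2r ?invr_gt0// ler_pdivrMr//.
    have := nf k; lra.
  - by move=> m; apply: sumCf.
have H2 : {ae P, forall w, exists N, forall k, (N <= k)%N ->
    ~ (((2 ^+ d) ^+ K k * c0)%:E <=
       psum X (EFin \o dyadic_kernel (n k - 1) (n k + 1) (K k)) w)%E}.
  apply: (@borel_cantelli_bound _ _ _ _ _ (fun k => (2 * 2 ^+ d / c0) / f (n k))
    ((2 * 2 ^+ d / c0) * M)).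
  - move=> k; apply: mge; [exact: measurable_dyadic_kernel|exact: dyadic_kernel_ge0].
  - move=> k; have nk := n2 k; have [Kk kK] := hK k.
    have q0 : 0 < (2 ^+ d) ^+ K k :> R by rewrite exprn_gt0.
    apply: (le_trans (dyadic_kernel_large _ _ _ _)); [lra|lra|exact: mulr_gt0|].
    have fn0 := f0 k; move: kK; rewrite exprS lee_fin.
    move: (2 ^+ d : R) q0 D0 (f (n k)) fn0 => D; move: (D ^+ K k) => q q0 Dp y y0 yq.
    have -> : 2 * D / c0 / y = (2 / (q * c0)) * (D * q / y).
      by field; rewrite !gt_eqF.
    have qc0 : 0 <= 2 / (q * c0) by rewrite divr_ge0// mulr_ge0 ?(ltW q0) ?(ltW c00).
    by rewrite ler_peMr// ler_pdivlMr// mul1r ltW.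
  - move=> m; apply: sumCf.
    exact: (divr_ge0 (mulr_ge0 (ler0n _ 2) (ltW D0)) (ltW c00)).
have H3 : {ae P, forall w, exists N, forall k, (N <= k)%N ->
    ~ ((f (n k))%:E <=
       psum X (EFin \o dyadic_sum (n k - 1) (n k + 1) (K k)) w)%E}.
  apply: (@borel_cantelli_bound _ _ _ _ _ (fun k => 180 / f (n k)) (180 * M)).
  - move=> k; apply: mge; [exact: measurable_dyadic_sum|exact: dyadic_sum_ge0].
  - move=> k; have nk := n2 k; have [Kk kK] := hK k.
    by apply: dyadic_sum_large => //; lra.
  - by move=> m; apply: sumCf.
apply: filterS3 H1 H2 H3 => w [m1 h1] [m2 h2] [m3 h3].
exists (N + maxn m1 (maxn m2 m3)).+1%:R => t Nt.
have t0 : 0 <= t by apply: le_trans (ltW Nt).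
have /andP[kt tk] := truncn_itv t0.
have Nk : (N + maxn m1 (maxn m2 m3) <= Num.truncn t)%N.
  by rewrite -ltnS -(ltr_nat R); apply: lt_trans tk; apply: le_lt_trans Nt; rewrite ler_nat.
have [k kE] : exists k, Num.truncn t = (N + k)%N by exists (Num.truncn t - N)%N; lia.
have {}Nk : (maxn m1 (maxn m2 m3) <= k)%N by move: Nk; rewrite kE leq_add2l.
move: kt tk; rewrite kE -natr1 -/(n k) => kt tk.
have nk := n2 k.
move: Nk; rewrite !geq_max => /and3P[/h1 k1 /h2 k2 /h3 k3].
have ft : f (n k) <= f t by apply: f_ndecr => //; lra.
rewrite (@mild_solution0_split _ _ _ _ _ _ _ hnoise (n k - 1)); last lra.
apply: (@le_trans _ _ ((2 ^+ d)%:E * (2 * f (n k))%:E + (2 ^+ d)%:E * (f (n k))%:E)%E); last first.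
  rewrite -!EFinM -EFinD lee_fin.
  have -> : 2 ^+ d * (2 * f (n k)) + 2 ^+ d * f (n k) = 3 * 2 ^+ d * f (n k) by ring.
  by rewrite ler_pM2l// mulr_gt0.
apply: leeD.
  apply: le_trans (old_sum_le w _ kt (ltW tk)) _; first by rewrite (leq_trans N2)// leq_addr.
  rewrite lee_pmul2l ?lte_fin// leNgt; apply/negP => H; apply: k1.
  apply: le_trans (ltW H); rewrite lee_fin; have := nf k; lra.
have a0 : 0 <= n k - 1 by lra.
have abE : n k + 1 = n k - 1 + 2 by ring.
have small : (psum X (EFin \o dyadic_kernel (n k - 1) (n k + 1) (K k)) w <
    ((2 ^+ d) ^+ K k * c0)%:E)%E by rewrite ltNge; apply/negP.
apply: le_trans (recent_sum_le abE (ltW tk) (points_are_far small)) _.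
by rewrite lee_pmul2l ?lte_fin// leNgt; apply/negP => H; apply: k3; exact: ltW.
Qed.

End eventual_bound.

Variable f : R -> R.
Hypothesis f_gt0 : forall t : R, 0 < t -> 0 < f t.
Hypothesis f_ndecr : forall s t : R, 0 < s -> s <= t -> f s <= f t.
Hypothesis f_fin :
  (\int[@lebesgue_measure R]_(t in `[1%R, +oo[) ((f t)^-1)%:E < +oo)%E.

Lemma limsup_mild_solution0_zero : {ae P, forall w,
  limf_esup (fun t : R => mild_solution0 tau eta t w / (f t)%:E)%E
    (pinfty_nbhs R) = 0%E}.
Proof.
have [M fM] := sum_inv_bounded f_gt0 f_ndecr f_fin.
(* Dividing [f] by a constant preserves the summability of the reciprocals, so the bound holds with
   arbitrarily small constants. *)
pose g (j : nat) (t : R) := f t / j.+1%:R.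
have g0 j t : 0 < t -> 0 < g j t by move=> t0; rewrite divr_gt0// f_gt0.
have gn j s t : 0 < s -> s <= t -> g j s <= g j t.
  by move=> s0 st; rewrite ler_pM2r ?invr_gt0//; exact: f_ndecr.
have gM j n : \sum_(k < n) (g j k.+2%:R)^-1 <= M * j.+1%:R.
  under eq_bigr do rewrite invfM invrK.
  by rewrite -mulr_suml ler_pM2r.
have H := ae_foralln (fun j => mild_solution0_eventually_le (g0 j) (gn j) (gM j)).
apply: filterS H => w hw; apply/eqP; rewrite eq_le; apply/andP; split; last first.
  apply: limf_esup_ge => L; exists (Num.max L 0 + 1).
    by rewrite (le_lt_trans (_ : L <= Num.max L 0)) ?le_max ?lexx// ltrDl.
  rewrite inver; case: ifPn => _; apply: mule_ge0 => //; try exact: mild_solution0_ge0.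
  by rewrite lee_fin invr_ge0 ltW// f_gt0// ltr_wpDl// le_max lexx orbT.
apply/lee_addgt0Pr => x x0; rewrite add0e.
pose j := Num.truncn (3 * 2 ^+ d / x).
have [N hN] := hw j; apply: (@limf_esup_le _ _ _ (Num.max N 0)) => t.
rewrite gt_max => /andP[Nt t0]; have ft := f_gt0 t0.
rewrite inver gt_eqF// lee_pdivrMr//; apply: (le_trans (hN t Nt)).
rewrite -EFinM lee_fin /g mulrA mulrAC ler_pM2r// ler_pdivrMr// -ler_pdivrMl//.
by rewrite mulrC; apply/ltW/truncnS_gt.
Qed.

End limsup_zero.

Theorem theorem1 (R : realType) (d : nat) (hd : (1 <= d)%N)
    (f : R -> R)
    (f_gt0 : forall t : R, 0 < t -> 0 < f t)
    (f_ndecr : forall s t : R, 0 < s -> s <= t -> f s <= f t)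
    (dT : measure_display) (T : measurableType dT) (P : probability T R)
    (tau : nat -> T -> R) (eta : nat -> T -> d.-tuple R)
    (hnoise : is_standard_poisson_noise P tau eta) :
  [/\ (\int[@lebesgue_measure R]_(t in `[1%R, +oo[) ((f t)^-1)%:E = +oo)%E ->
        {ae P, forall w,
          limf_esup (fun t : R => mild_solution0 tau eta t w / (f t)%:E)%E
            (pinfty_nbhs R) = +oo%E},
      (\int[@lebesgue_measure R]_(t in `[1%R, +oo[) ((f t)^-1)%:E < +oo)%E ->
        {ae P, forall w,
          limf_esup (fun t : R => mild_solution0 tau eta t w / (f t)%:E)%E
            (pinfty_nbhs R) = 0%E} &
      {ae P, forall w,
        limf_einf (fun t : R => mild_solution0 tau eta t w / t%:E)%E
          (pinfty_nbhs R) = 1%E}].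
Proof.
have [mu muE] := exists_space_time_measure (R := R) d; split.
- move=> f_int.
  exact: (limsup_mild_solution0_infinite hnoise muE hd f_gt0 f_ndecr f_int).
- move=> f_int.
  exact: (limsup_mild_solution0_zero hnoise muE hd f_gt0 f_ndecr f_int).
- exact: (liminf_mild_solution0 hnoise muE).
Qed.
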